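(* Let $C\in\mathcal C^2$, let $(U_1,V_1),(U_2,V_2),\dots$ be i.i.d. with distribution function $C$, let $E_n$ be the empirical copula of $(U_1,V_1),\dots,(U_n,V_n)$, fix $s\in(0,\tfrac12)$ and set $N(n)=\lfloor n^s\rfloor$. Then with probability one, for $\lambda$-almost every $x\in\mathbb I$, $$\lim_{n\to\infty}r_{\mathfrak{Cb}_{N(n)}(E_n)}(x)=r_C(x),$$ and in particular $\lim_{n\to\infty}\|r_{\mathfrak{Cb}_{N(n)}(E_n)}-r_C\|_p=0$ for every $p\in[1,\infty)$, where $\|f\|_p=(\int_{\mathbb I}|f|^p\,\mathrm d\lambda)^{1/p}$.
   Context: $\mathbb I=[0,1]$, $\lambda$ Lebesgue measure. A bivariate copula $C\in\mathcal C^2$ is the distribution function on $\mathbb I^2$ of a probability measure $\mu_C$ with uniform marginals. $K_C(x,\cdot)$ is the Markov kernel (conditional distribution of the second coordinate given the first), $\mu_C(B\times F)=\int_B K_C(x,F)\,\mathrm d\lambda(x)$, and $r_C(x)=\int y\,K_C(x,\mathrm dy)$. The empirical copula $E_n$ is the bilinear interpolation of the empirical subcopula induced by the (pseudo-)ranks of the sample. For $N\in\mathbb N$ and a copula $D\in\mathcal C^2$, the checkerboard approximation $\mathfrak{Cb}_N(D)$ is the copula with density $N^2\sum_{i,j=1}^N\mu_D(I_{N,i}\times I_{N,j})\mathbf 1_{I_{N,i}\times I_{N,j}}$, where $I_{N,i}=(\frac{i-1}N,\frac iN)$. *)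

(* Defs.v *)
From mathcomp Require Import all_boot all_order all_algebra.
From mathcomp Require Import all_classical all_reals all_analysis.
Import Order.TTheory GRing.Theory Num.Theory.
Set Implicit Arguments.
Unset Strict Implicit.
Unset Printing Implicit Defensive.

Local Open Scope classical_set_scope.
Local Open Scope ring_scope.

Section CopulaDefs.
Context {R : realType}.

Definition I01 : set R := [set x | 0 <= x <= 1].

(* open interval I_{N,i} = ((i-1)/N, i/N), written here with 0-based i:
   (i/N, (i+1)/N) for i = 0, ..., N-1 *)
Definition cellI (N i : nat) : set R :=
  [set x | i%:R / N%:R < x < i.+1%:R / N%:R].

(* mu is the doubly stochastic measure mu_C of a bivariate copula C:
   a probability measure on R^2 with uniform marginals on I
   (hence concentrated on I^2). *)
Definition is_copula_measure (mu : probability (R * R)%type R) : Prop :=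
  (forall A : set R, measurable A ->
     mu (A `*` setT) = lebesgue_measure (A `&` I01)) /\
  (forall A : set R, measurable A ->
     mu (setT `*` A) = lebesgue_measure (A `&` I01)).

Definition markov_kernel_of (mu : set (R * R) -> \bar R)
    (k : R.-pker R ~> R) : Prop :=
  forall B F : set R, measurable B -> measurable F -> B `<=` I01 ->
    (\int[lebesgue_measure]_(x in B) k x F)%E = mu (B `*` F).

Definition rfun (k : R.-pker R ~> R) (x : R) : R :=
  fine (\int[k x]_y (y%:E))%E.

Definition rank (n : nat) (X : nat -> R) (k : nat) : nat :=
  #|[set l : 'I_n | X l <= X k]|.

(* empirical subcopula on the grid: E'_n(i/n, j/n) *)
Definition emp_subcopula (n : nat) (U V : nat -> R) (i j : int) : R :=
  n%:R^-1 * (#|[set k : 'I_n | ((rank n U k)%:Z <= i) && ((rank n V k)%:Z <= j)]|)%:R.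

(* empirical copula E_n: bilinear interpolation of the empirical subcopula
   of the sample (U_0,V_0), ..., (U_{n-1},V_{n-1}) (relevant on I^2) *)
Definition emp_copula (n : nat) (U V : nat -> R) (u v : R) : R :=
  let i := Num.floor (n%:R * u) in
  let j := Num.floor (n%:R * v) in
  let a := n%:R * u - i%:~R in
  let b := n%:R * v - j%:~R in
  (1 - a) * (1 - b) * emp_subcopula n U V i j
  + a * (1 - b) * emp_subcopula n U V (i + 1) j
  + (1 - a) * b * emp_subcopula n U V i (j + 1)
  + a * b * emp_subcopula n U V (i + 1) (j + 1).

(* mu_D(I_{N,i} x I_{N,j}) for a copula D, computed as the D-volume of the
   rectangle (copulas are continuous, so boundaries carry no mass) *)
Definition cell_mass (D : R -> R -> R) (N i j : nat) : R :=
  D (i.+1%:R / N%:R) (j.+1%:R / N%:R) - D (i%:R / N%:R) (j.+1%:R / N%:R)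
  - D (i.+1%:R / N%:R) (j%:R / N%:R) + D (i%:R / N%:R) (j%:R / N%:R).

Definition checkerboard_density (D : R -> R -> R) (N : nat) (p : R * R) : R :=
  N%:R ^+ 2 * \sum_(i < N) \sum_(j < N)
    cell_mass D N i j * \1_(cellI N i `*` cellI N j) p.

Definition checkerboard_measure (D : R -> R -> R) (N : nat)
    (A : set (R * R)) : \bar R :=
  (\int[(@lebesgue_measure R) \x (@lebesgue_measure R)]_(p in A)
     (checkerboard_density D N p)%:E)%E.

Definition Nseq (s : R) (n : nat) : nat := Num.truncn (n%:R `^ s).

Definition Lpnorm01 (p : R) (f : R -> R) : \bar R :=
  ((\int[lebesgue_measure]_(x in I01) (`|f x| `^ p)%:E) `^ p^-1)%E.

End CopulaDefs.

Definition iid_with {R : realType} {d} {T : measurableType d}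
    (P : probability T R) (X : nat -> T -> (R * R)%type)
    (mu : set (R * R) -> \bar R) : Prop :=
  (forall n, measurable_fun setT (X n)) /\
  (forall n (A : set (R * R)), measurable A -> P (X n @^-1` A) = mu A) /\
  (forall n (A : nat -> set (R * R)), (forall i, measurable (A i)) ->
     P (\bigcap_(i in `I_n) (X i @^-1` A i)) =
     (\prod_(i < n) P (X i @^-1` A i))%E).

(* Main.v *)
(* Write N = N(n) and let x lie in the i-th cell of the partition of [0, 1] into N
   intervals.  A kernel K of the checkerboard copula gives mass N m_ij to the j-th
   cell, so r(x) is within 1/(2N) of sum_j (j + 1/2) m_ij.  Summation by parts
   turns an error e on the values of the copula at the grid points into an error
   O(N e) on this sum (a bound term by term would only give O(N^2 e)).  By Chernoff
   bounds and Borel-Cantelli the error of E_n at the grid points is almost surely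
   O(n^-t) for every t < 1/2, and N n^-t -> 0 as soon as t > s.  It remains to
   compare with the averages of r_C over the cell containing x, which converge to
   r_C(x) at almost every x by Lebesgue differentiation; the L^p statement follows
   by dominated convergence. *)
Require Import Defs.
From mathcomp Require Import all_boot all_order all_algebra.
From mathcomp Require Import all_classical all_reals all_analysis.
From mathcomp Require Import measurable_realfun ring lra.
Import Order.TTheory GRing.Theory Num.Theory numFieldNormedType.Exports.
Set Implicit Arguments.
Unset Strict Implicit.
Unset Printing Implicit Defensive.
Local Open Scope classical_set_scope.
Local Open Scope ring_scope.

(** * Concentration of empirical frequencies *)

(** The kernels are arbitrary versions, fixed only up to null sets, and the mean at an exceptional
    point need not exist. Facts about them are therefore extracted from integrals over subsets of a
    cell and hold for almost every x, simultaneously for the countably many n and cells.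

    Randomness enters only through the values of E_n at the grid points. Ranks are dependent, so
    concentration is applied not to E_n but to counts of sample points in deterministic quadrants
    and half-planes. With e = n^-t the Chernoff exponent n e^2 / 8 = n^(1-2t) / 8 is a positive
    power of n because t < 1/2, and this beats the polynomial number of grid points in the union
    bound. *)

Lemma measure_bigsetU_le d (T : measurableType d) (R : realType)
    (mu : {measure set T -> \bar R}) (I : Type) (r : seq I) (Q : pred I)
    (F : I -> set T) : (forall i, measurable (F i)) ->
  (mu (\big[setU/set0]_(i <- r | Q i) F i) <= \sum_(i <- r | Q i) mu (F i))%E.
Proof.
move=> mF; elim: r => [|i r IH]; first by rewrite !big_nil measure0.
rewrite !big_cons; case: ifP => // _.
apply: (le_trans (measureU2 _ _ _)) => //; last exact: leeD2l.
exact: bigsetU_measurable.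
Qed.

(** From 1 - x <= exp(-x) one gets exp(x) <= 1 / (1 - x), and this is at most the quadratic as long
    as x <= 1/2. *)
Lemma expR_le_quad (R : realType) (x : R) : x <= 1 / 2 ->
  expR x <= 1 + x + 2 * x ^+ 2.
Proof.
move=> x2.
have h4 : 1 <= (1 + x + 2 * x ^+ 2) * (1 - x).
  have -> : (1 + x + 2 * x ^+ 2) * (1 - x) = 1 + x ^+ 2 * (1 - 2 * x) by ring.
  by rewrite lerDl mulr_ge0 ?sqr_ge0//; lra.
have h5 : 0 < 1 - x by lra.
have h1 : expR x * expR (- x) = 1 by rewrite -expRD subrr expR0.
have h3 : expR x * (1 - x) <= 1.
  by rewrite -[leRHS]h1 ler_pM2l ?expR_gt0//; exact: expR_ge1Dx.
by rewrite -(ler_pM2r h5) (le_trans h3).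
Qed.

(** Moment generating function of a centred Bernoulli variable: in the quadratic bounds the linear
    terms cancel and the variance p (1 - p) is at most 1. *)
Lemma bernoulli_mgf_le (R : realType) (p t : R) : 0 <= p <= 1 -> 0 <= t <= 1 / 2 ->
  p * expR (t * (1 - p)) + (1 - p) * expR (- (t * p)) <= expR (2 * t ^+ 2).
Proof.
move=> /andP[p0 p1] /andP[t0 t1].
apply: le_trans (expR_ge1Dx _).
have h1 : expR (t * (1 - p)) <= 1 + t * (1 - p) + 2 * (t * (1 - p)) ^+ 2.
  by apply: expR_le_quad; nra.
have h2 : expR (- (t * p)) <= 1 + - (t * p) + 2 * (- (t * p)) ^+ 2.
  by apply: expR_le_quad; nra.
apply: (le_trans (lerD (ler_wpM2l p0 h1) (ler_wpM2l _ h2))); first by lra.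
have -> : p * (1 + t * (1 - p) + 2 * (t * (1 - p)) ^+ 2) +
  (1 - p) * (1 + - (t * p) + 2 * (- (t * p)) ^+ 2) =
  1 + 2 * t ^+ 2 * (p * (1 - p)) by ring.
rewrite lerD2l -[leRHS]mulr1 ler_wpM2l//; first by rewrite mulr_ge0 ?sqr_ge0.
nra.
Qed.

(** Chernoff's method, with the binomial law as a sum over the sets [J] of successes, the form that
    independence delivers. Each [J] in the tail has exp(t (|J| - n (p + e))) >= 1; inserting this
    factor and dropping the restriction on [J] leaves a product of moment generating functions. *)
Lemma binomial_tail (R : realType) (p e : R) (n : nat) :
  0 <= p <= 1 -> 0 <= e <= 2 ->
  \sum_(J : {set 'I_n} | n%:R * (p + e) <= #|J|%:R)
     \prod_(i < n) (if i \in J then p else 1 - p) <= expR (- (n%:R * e ^+ 2 / 8)).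
Proof.
move=> p01 e02; have /andP[p0 p1] := p01; have /andP[e0 e2] := e02.
(* This minimises 2 t^2 - t e, with value - e^2 / 8; the bound e <= 2 keeps t <= 1/2. *)
pose t := e / 4.
have prod0 (J : {set 'I_n}) : 0 <= \prod_(i < n) (if i \in J then p else 1 - p).
  by apply: prodr_ge0 => i _; case: ifP => _ //; lra.
have -> : expR (- (n%:R * e ^+ 2 / 8)) =
    expR (- (t * n%:R * e)) * expR (2 * t ^+ 2) ^+ n.
  rewrite -expRM_natl -expRD; congr expR; rewrite /t.
  by field.
apply: (@le_trans _ _ (expR (- (t * n%:R * e)) *
  \prod_(i < n) (p * expR (t * (1 - p)) + (1 - p) * expR (- (t * p))))); last first.
  rewrite prodr_const card_ord ler_wpM2l ?expR_ge0//.
  apply: lerXn2r; rewrite ?nnegrE ?expR_ge0//.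
  - by rewrite addr_ge0// mulr_ge0 ?expR_ge0//; lra.
  - by apply: bernoulli_mgf_le => //; rewrite /t; lra.
rewrite bigA_distr mulr_sumr/= big_mkcond/=; apply: ler_sum => J _.
have <- : \prod_(i < n) (if i \in J then p else 1 - p) *
  (\prod_(i < n) (if i \in J then expR (t * (1 - p)) else expR (- (t * p)))) =
  \prod_(i < n) (if i \in J then p * expR (t * (1 - p))
                 else (1 - p) * expR (- (t * p))).
  by rewrite -big_split/=; apply: eq_bigr => i _; case: ifP.
have -> : \prod_(i < n) (if i \in J then expR (t * (1 - p)) else expR (- (t * p))) =
  expR (t * (#|J|%:R - n%:R * p)).
  rewrite (eq_bigr (fun i : 'I_n => expR (t * ((i \in J)%:R - p)))); last first.
    by move=> i _; case: ifP => _; rewrite ?sub0r ?mulrN.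
  rewrite -expR_sum -mulr_sumr big_split/= sumrN sumr_const card_ord mulr_natl.
  have -> : #|J|%:R = \sum_(i < n) (i \in J)%:R :> R; last by [].
  rewrite -sum1_card natr_sum big_mkcond/=.
  by apply: eq_bigr => i _; case: ifP.
case: ifP => [bJ|_]; last first.
  by rewrite mulr_ge0 ?expR_ge0// mulr_ge0 ?expR_ge0.
rewrite mulrCA -[leLHS]mulr1 ler_wpM2l// -expRD -[leLHS]expR0 ler_expR.
have -> : - (t * n%:R * e) + t * (#|J|%:R - n%:R * p) =
  t * (#|J|%:R - n%:R * (p + e)) by ring.
by rewrite mulr_ge0 ?subr_ge0// /t; lra.
Qed.

Definition freq_count {R : realType} {T : Type} (X : nat -> T -> R * R)
  (n : nat) (A : set (R * R)) (w : T) : nat := #|[set k : 'I_n | X k w \in A]%SET|.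

Section iid.
Context {R : realType} {d : measure_display} {T : measurableType d}.
Variables (P : probability T R) (X : nat -> T -> (R * R)%type).
Variable mu : probability (R * R)%type R.
Hypothesis iidX : iid_with P X mu.

(** The event that exactly the indices in [J] hit [A], put in the shape of the independence
    hypothesis; [insub] is there because that hypothesis indexes its sets by all naturals. *)
Let pattern n (A : set (R * R)) (J : {set 'I_n}) : set T :=
  \bigcap_(i in `I_n) (X i @^-1` (if insub i is Some k then
     if k \in J then A else ~` A else setT)).

Let pattern_prob n A (J : {set 'I_n}) : measurable A ->
  P (pattern A J) =
  (\prod_(i < n) (if i \in J then fine (mu A) else 1 - fine (mu A)))%:E.
Proof.
move=> mA; have [mX [lawX indX]] := iidX.
rewrite /pattern indX; last first.
  by move=> i; case: insubP => //= k _ _; case: ifP => // _; exact: measurableC.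
rewrite -prodEFin; apply: eq_bigr => i _; rewrite valK.
case: ifP => _; rewrite lawX ?probability_setC//; last exact: measurableC.
- by rewrite fineK// fin_num_measure.
- by rewrite EFinB fineK// fin_num_measure.
Qed.

Let pattern_measurable n A (J : {set 'I_n}) : measurable A ->
  measurable (pattern A J).
Proof.
move=> mA; have [mX _] := iidX; apply: bigcap_measurableType => i _.
rewrite -[X in measurable X]setTI; apply: mX => //.
by case: insubP => //= k _ _; case: ifP => // _; exact: measurableC.
Qed.

Let patternE n A (J : {set 'I_n}) w :
  pattern A J w <-> [set k : 'I_n | X k w \in A]%SET = J.
Proof.
split => [h|<- i /= ni].
  apply/setP => k; have := h k (ltn_ord k); rewrite /= valK inE.
  by case: ifP => _ Ak; [rewrite mem_set|rewrite memNset].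
rewrite insubT /= inE; case: ifP => [|/negP/negP]; first by rewrite inE.
by rewrite notin_setE.
Qed.

(** Splitting by the set of hits reduces both the measurability and the probability of the tail to
    finitely many patterns. *)
Let upper_tail n A (e : R) :
  [set w | n%:R * (fine (mu A) + e) <= (freq_count X n A w)%:R] =
  \big[setU/set0]_(J : {set 'I_n} | n%:R * (fine (mu A) + e) <= #|J|%:R)
    pattern A J.
Proof.
apply/seteqP; split => [w /= h|w].
  rewrite -bigcup_seq_cond/=.
  exists [set k : 'I_n | X k w \in A]%SET; last exact/patternE.
  by apply/andP; split; [exact: mem_index_enum|exact: h].
by rewrite -bigcup_seq_cond/= => -[J /andP[_ h] /patternE HJ]; rewrite /freq_count HJ.
Qed.

Lemma measurable_upper_tail n (A : set (R * R)) (e : R) : measurable A ->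
  measurable [set w | n%:R * (fine (mu A) + e) <= (freq_count X n A w)%:R].
Proof.
by move=> mA; rewrite upper_tail; apply: bigsetU_measurable => J _;
  exact: pattern_measurable.
Qed.

Lemma upper_tail_prob n (A : set (R * R)) (e : R) : measurable A -> 0 <= e <= 2 ->
  (P [set w | (n%:R * (fine (mu A) + e) <= (freq_count X n A w)%:R)%R]
    <= (expR (- (n%:R * e ^+ 2 / 8)))%:E)%E.
Proof.
move=> mA e02; rewrite upper_tail.
apply: (le_trans (measure_bigsetU_le _ _ _ _)) => [J|].
  exact: pattern_measurable.
rewrite (eq_bigr _ (fun J _ => pattern_prob J mA)) sumEFin lee_fin.
apply: binomial_tail => //.
by rewrite fine_ge0//= -lee_fin fineK ?fin_num_measure// probability_le1.
Qed.

Lemma freq_countC n (A : set (R * R)) w : (freq_count X n (~` A) w + freq_count X n A w)%N = n.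
Proof.
rewrite -[RHS]card_ord -cardsT -(cardsID [set k : 'I_n | X k w \in A]%SET [set: _]) addnC.
congr (_ + _)%N; rewrite /freq_count; apply: eq_card => k; rewrite !inE//.
by rewrite andbT; apply/idP/idP; rewrite in_setC.
Qed.

End iid.

Lemma telescoping_series_lty (R : realType) (c : R) : 0 <= c ->
  (\sum_(n <oo) (c / (n.+1%:R * n.+2%:R))%:E < +oo)%E.
Proof.
move=> c0; apply: (@le_lt_trans _ _ c%:E); last exact: ltry.
apply: lime_le.
  by apply: is_cvg_nneseries => n _ _; rewrite lee_fin divr_ge0// mulr_ge0.
apply: nearW => n; rewrite sumEFin lee_fin.
suff -> : \sum_(0 <= i < n) c / (i.+1%:R * i.+2%:R) = c - c / n.+1%:R.
  by rewrite gerBl divr_ge0.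
elim: n => [|n IH]; first by rewrite big_nil divr1 subrr.
rewrite big_nat_recr//= IH -[n.+2%:R]natr1 -[n.+1%:R]natr1.
have n0 : 0 <= n%:R :> R by [].
by field; rewrite !gt_eqF//; lra.
Qed.

Lemma borel_cantelli_ae d (T : measurableType d) (R : realType)
    (P : {measure set T -> \bar R}) (c : R) (B : (set T)^nat) :
  0 <= c -> (forall n, measurable (B n)) ->
  (forall n, P (B n) <= (c / (n.+1%:R * n.+2%:R))%:E)%E ->
  \forall w \ae P, \forall n \near \oo, ~ B n w.
Proof.
move=> c0 mB PB.
have B0 : P (lim_sup_set B) = 0%E.
  apply: lim_sup_set_cvg0 => //.
  apply: le_lt_trans (telescoping_series_lty c0).
  by apply: lee_nneseries => // n _; exact: PB.
exists (lim_sup_set B); split => //.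
  by apply: bigcap_measurableType => k _; exact: bigcup_measurable.
move=> w /= hw n _; apply: contrapT => hn; apply: hw.
by exists n => // k /= nk Bk; apply: hn; exists k.
Qed.

(** The left side is the union bound to come, two tails for each of (n+2)^2 pairs of indices; the
    right side is the telescoping rate. *)
Lemma expR_neg_poly_decay (R : realType) (a : R) : 0 < a ->
  exists2 c : R, 0 <= c & forall n : nat,
    n.+2%:R ^+ 2 * (2 * expR (- (n.+1%:R `^ a / 8))) <= c / (n.+1%:R * n.+2%:R).
Proof.
move=> a0.
(* The term y^k / k! of the exponential series, y = N^a / 8, then dominates a multiple of N^4: two
   powers pay for the number of pairs and two for the summable rate. *)
have [k k1 ka] : exists2 k : nat, (0 < k)%N & 4 <= a * k%:R.
  have [m hm] : exists m : nat, 4 / a < m%:R.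
    by exists (Num.truncn (4 / a)).+1; exact: truncnS_gt.
  exists m; last by rewrite mulrC -ler_pdivrMr// ltW.
  by rewrite -(ltr_nat R) (le_lt_trans _ hm)// divr_ge0// ltW.
(* 16 = 2 * 2^3: the two tails, and ((N + 1) / N)^3 <= 2^3. *)
exists (16 * (k`!%:R * 8 ^+ k)); first by rewrite !mulr_ge0.
move=> n; set N : R := n.+1%:R.
have N1 : 1 <= N by rewrite /N ler1n.
have N0 : 0 < N by exact: lt_le_trans N1.
set y := N `^ a / 8.
have y0 : 0 < y by rewrite divr_gt0// powR_gt0.
have kf0 : 0 < k`!%:R :> R by rewrite ltr0n fact_gt0.
have h1 : y ^+ k / k`!%:R <= expR y.
  have := @expR_ge1Dxn R y k.-1 (ltW y0); rewrite prednK//.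
  by apply: le_trans; rewrite lerDr.
have h2 : N ^+ 4 / 8 ^+ k <= y ^+ k.
  rewrite /y expr_div_n ler_pM2r ?invr_gt0 ?exprn_gt0//.
  rewrite -[leRHS]powR_mulrn ?powR_ge0// -powRrM.
  by rewrite -[leLHS]powR_mulrn ?(ltW N0)// ler_powR.
have h3 : N ^+ 4 / (k`!%:R * 8 ^+ k) <= expR y.
  by apply: le_trans h1; rewrite invfM mulrCA mulrC ler_pM2r ?invr_gt0.
have h4 : expR (- y) <= (k`!%:R * 8 ^+ k) / N ^+ 4.
  rewrite expRN -[leRHS]invf_div lef_pV2// posrE ?expR_gt0//.
  by rewrite divr_gt0 ?exprn_gt0// mulr_gt0 ?exprn_gt0.
have -> : n.+2%:R = N + 1 :> R by rewrite /N natr1.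
set c := k`!%:R * 8 ^+ k in h4 *.
have c0 : 0 <= c by rewrite /c mulr_ge0.
rewrite ler_pdivlMr; last by rewrite mulr_gt0// addr_gt0.
apply: (@le_trans _ _ ((N + 1) ^+ 2 * (2 * (c / N ^+ 4)) * (N * (N + 1)))).
  rewrite ler_pM2r; last by rewrite mulr_gt0// addr_gt0.
  by rewrite ler_pM2l ?exprn_gt0 ?addr_gt0// ler_pM2l.
have -> : (N + 1) ^+ 2 * (2 * (c / N ^+ 4)) * (N * (N + 1)) =
   2 * c * ((N + 1) / N) ^+ 3 by field; rewrite gt_eqF.
have -> : 16 * c = 2 * c * 2 ^+ 3 by ring.
rewrite ler_wpM2l ?mulr_ge0// lerXn2r ?nnegrE//.
- by rewrite divr_ge0// ltW// addr_gt0.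
- by rewrite ler_pdivrMr//; lra.
Qed.

Section deviation.
Context {R : realType} {d : measure_display} {T : measurableType d}.
Variables (P : probability T R) (X : nat -> T -> (R * R)%type).
Variable mu : probability (R * R)%type R.
Hypothesis iidX : iid_with P X mu.

(** A lower deviation for [A] is an upper deviation for its complement, so the one-sided bound
    serves twice. *)
Let deviation n (A : set (R * R)) (e : R) : set T :=
  [set w | n%:R * (fine (mu A) + e) <= (freq_count X n A w)%:R] `|`
  [set w | n%:R * (fine (mu (~` A)) + e) <= (freq_count X n (~` A) w)%:R].

Let deviation_measurable n A e : measurable A -> measurable (deviation n A e).
Proof.
move=> mA; have mCA := measurableC mA.
by apply: measurableU; apply: (measurable_upper_tail iidX).
Qed.

Let deviation_prob n A (e : R) : measurable A -> 0 <= e <= 2 ->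
  (P (deviation n A e) <= (2 * expR (- (n%:R * e ^+ 2 / 8)))%:E)%E.
Proof.
move=> mA e02; have mCA := measurableC mA.
apply: (le_trans (measureU2 _ _ _)); try exact: (measurable_upper_tail iidX).
by rewrite [2 * _]mulr_natl mulr2n EFinD; apply: leeD; exact: (upper_tail_prob iidX).
Qed.

Let deviationP n A (e : R) w : measurable A -> (0 < n)%N -> ~ deviation n A e w ->
  `|(freq_count X n A w)%:R / n%:R - fine (mu A)| <= e.
Proof.
move=> mA n0 /not_orP[/negP]; rewrite -ltNge => h1 /negP; rewrite -ltNge.
have n0' : 0 < n%:R :> R by rewrite ltr0n.
have -> : fine (mu (~` A)) = 1 - fine (mu A).
  by rewrite probability_setC// fineB ?fin_num_measure.
have := freq_countC X n A w => /(congr1 (fun k => k%:R : R)); rewrite natrD => h2 h3.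
have h4 : (freq_count X n A w)%:R / n%:R < fine (mu A) + e by rewrite ltr_pdivrMr 1?mulrC.
have h5 : fine (mu A) - e < (freq_count X n A w)%:R / n%:R.
  by rewrite ltr_pdivlMr//; nra.
by rewrite ler_norml; apply/andP; split; lra.
Qed.

(** The sets may vary with [n] but not with [w], so the tail bound applies to each; the union bound
    makes the estimate uniform in [i] and [j]. *)
Lemma freq_count_near (t : R) (A : nat -> nat -> nat -> set (R * R)) :
  0 < t < 1 / 2 -> (forall n i j, measurable (A n i j)) ->
  \forall w \ae P, \forall n \near \oo, forall i j, (i <= n)%N -> (j <= n)%N ->
    `|(freq_count X n (A n i j) w)%:R / n%:R - fine (mu (A n i j))|
       <= n%:R `^ (- t).
Proof.
move=> /andP[t0 t2] mA.
have a0 : 0 < 1 - 2 * t by lra.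
have [c c0 hc] := expR_neg_poly_decay a0.
(* Sample size n + 1 avoids the empty sample; the indices up to n + 1 then number n + 2. *)
pose D n i j := deviation n.+1 (A n.+1 i j) (n.+1%:R `^ (- t)).
pose B n := \big[setU/set0]_(p : 'I_n.+2 * 'I_n.+2) D n p.1 p.2.
have mB n : measurable (B n).
  by apply: bigsetU_measurable => p _; exact: deviation_measurable.
have PB n : (P (B n) <= (c / (n.+1%:R * n.+2%:R))%:E)%E.
  apply: (le_trans (measure_bigsetU_le _ _ _ _)) => [p|].
    exact: deviation_measurable.
  apply: (@le_trans _ _ (\sum_(p : 'I_n.+2 * 'I_n.+2)
    (2 * expR (- (n.+1%:R `^ (1 - 2 * t) / 8)))%:E)%E).
    apply: lee_sum => p _; apply: (le_trans (deviation_prob _ _ _)) => //.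
      rewrite powR_ge0/= powRN (@le_trans _ _ 1)//; last by lra.
      rewrite invf_le1 ?powR_gt0// -[leLHS](powRr0 n.+1%:R) ler_powR ?ler1n//.
      exact: ltW.
    rewrite lee_fin ler_pM2l// ler_expR lerN2 ler_pM2r ?invr_gt0//.
    rewrite -powR_mulrn ?powR_ge0// -powRrM powRD; last by rewrite pnatr_eq0 implybT.
    rewrite powRr1// ler_pM2l ?ltr0n//.
    by rewrite mulNr mulrC.
  rewrite sumEFin lee_fin sumr_const card_prod card_ord -[leLHS]mulr_natl natrM -expr2.
  exact: hc.
have := borel_cantelli_ae c0 mB PB.
apply: filterS => w [N _ hN]; exists N.+1 => // -[//|n] /= Nn i j ni nj.
apply: deviationP => // hD; apply: (hN n) => //.
rewrite /B -bigcup_seq/=; exists (Ordinal (ni : i < n.+2)%N, Ordinal (nj : j < n.+2)%N) => //=.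
by rewrite mem_index_enum.
Qed.

End deviation.

(** * The empirical copula at grid points *)

Section empirical.
Context {R : realType}.
Variables (n : nat) (U V : nat -> R).

Lemma emp_subcopulaE (i j : int) : emp_subcopula n U V i j = n%:R^-1 *
  #|[set k : 'I_n | ((rank n U k)%:Z <= i) && ((rank n V k)%:Z <= j)]%SET|%:R.
Proof.
congr (_ * _%:R); apply: eq_card => k; rewrite [RHS]inE.
by apply/idP/idP; rewrite inE.
Qed.

Lemma le_emp_subcopula (i j i' j' : int) : i <= i' -> j <= j' ->
  emp_subcopula n U V i j <= emp_subcopula n U V i' j'.
Proof.
move=> ii' jj'; rewrite !emp_subcopulaE ler_wpM2l ?invr_ge0// ler_nat.
apply: subset_leq_card; apply/fintype.subsetP => k; rewrite !inE => /andP[ki kj].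
by rewrite (le_trans ki) ?(le_trans kj).
Qed.

(** Bilinear interpolation is a convex combination of the four corner values, among which
    monotonicity makes the lower left the smallest and the upper right the largest. *)
Lemma emp_copula_between (u v : R) :
  emp_subcopula n U V (Num.floor (n%:R * u)) (Num.floor (n%:R * v))
    <= emp_copula n U V u v <=
  emp_subcopula n U V (Num.floor (n%:R * u) + 1) (Num.floor (n%:R * v) + 1).
Proof.
rewrite /emp_copula; set i := Num.floor _; set j := Num.floor _.
set a := n%:R * u - _; set b := n%:R * v - _.
have frac (x : R) : 0 <= x - (Num.floor x)%:~R <= 1.
  by rewrite subr_ge0 floor_le/= lerBlDl -intrD1 ltW// floorD1_gt.
have /andP[a0 a1] : 0 <= a <= 1 by exact: frac.
have /andP[b0 b1] : 0 <= b <= 1 by exact: frac.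
clearbody a b.
have i1 : i <= i + 1 by rewrite lerDl.
have j1 : j <= j + 1 by rewrite lerDl.
have := le_emp_subcopula (lexx i) j1.
have := le_emp_subcopula i1 (lexx j).
have := le_emp_subcopula (lexx (i + 1)) j1.
have := le_emp_subcopula i1 (lexx (j + 1)).
move: (emp_subcopula _ _ _ i j) (emp_subcopula _ _ _ i (j + 1)).
move: (emp_subcopula _ _ _ (i + 1) j) (emp_subcopula _ _ _ (i + 1) (j + 1)).
move=> S10 S11 S00 S01 h1 h2 h3 h4.
have h5 : 0 <= (1 - a) * (1 - b) by rewrite mulr_ge0 ?subr_ge0.
have h6 : 0 <= a * (1 - b) by rewrite mulr_ge0 ?subr_ge0.
have h7 : 0 <= (1 - a) * b by rewrite mulr_ge0 ?subr_ge0.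
have h8 : 0 <= a * b by rewrite mulr_ge0.
apply/andP; split.
- rewrite -subr_ge0 (_ : _ - _ = a * (1 - b) * (S10 - S00) +
    (1 - a) * b * (S01 - S00) + a * b * (S11 - S00)); last by ring.
  by rewrite !addr_ge0// mulr_ge0// subr_ge0//; lra.
- rewrite -subr_ge0 (_ : _ - _ = (1 - a) * (1 - b) * (S11 - S00) +
    a * (1 - b) * (S11 - S10) + (1 - a) * b * (S11 - S01)); last by ring.
  by rewrite !addr_ge0// mulr_ge0// subr_ge0//; lra.
Qed.

Let count (W : nat -> R) x := #|[set k : 'I_n | W k <= x]%SET|.
Let joint x y := #|[set k : 'I_n | (U k <= x) && (V k <= y)]%SET|.

(** This turns a cutoff on ranks into a threshold on the sample, ties included: if W k > x, the
    index k itself makes the set counted by its rank strictly larger than the set counted at x. *)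
Lemma rank_leE W x (k : 'I_n) : (rank n W k <= count W x)%N = (W k <= x).
Proof.
have -> : rank n W k = #|[set l : 'I_n | W l <= W k]%SET|.
  by apply: eq_card => l; rewrite [RHS]inE; apply/idP/idP; rewrite inE.
have [kx|xk] := leP (W k) x.
  by apply: subset_leq_card; apply/fintype.subsetP => l; rewrite !inE => /le_trans; apply.
apply/negbTE; rewrite -ltnNge; apply: proper_card; apply/properP; split.
  by apply/fintype.subsetP => l; rewrite !inE => /le_trans; apply; exact: ltW.
by exists k; rewrite !inE// -ltNge.
Qed.

Lemma emp_subcopula_ge x y (i j : int) :
  (count U x)%:Z <= i -> (count V y)%:Z <= j ->
  (joint x y)%:R / n%:R <= emp_subcopula n U V i j.
Proof.
move=> xi yj; rewrite emp_subcopulaE mulrC ler_wpM2l ?invr_ge0// ler_nat.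
apply: subset_leq_card; apply/fintype.subsetP => k; rewrite !inE -!rank_leE.
by move=> /andP[kx ky]; rewrite (le_trans _ xi) ?(le_trans _ yj).
Qed.

(** Sample points that the rank cutoff [i] admits although they lie beyond [x]. *)
Let outlier (W : nat -> R) x (i : int) :=
  [set k : 'I_n | ((rank n W k)%:Z <= i) && (x < W k)]%SET.

Let card_outlier_le W x (i : int) (e : R) : (0 < n)%N -> 0 <= e ->
  (i <= (count W x)%:Z) || (1 - (count W x)%:R / n%:R <= e) ->
  #|outlier W x i|%:R / n%:R <= e.
Proof.
move=> n0 e0 /orP[ix|].
  rewrite (_ : outlier W x i = finset.set0) ?cards0 ?mul0r//.
  apply/setP => k; rewrite !inE; apply/negP => /andP[ki].
  by rewrite ltNge -rank_leE -lez_nat (le_trans ki).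
apply: le_trans.
have nn0 : 0 < n%:R :> R by rewrite ltr0n.
rewrite ler_pdivrMr// mulrBl mul1r divfK ?gt_eqF// lerBrDr -natrD ler_nat.
rewrite -[leqRHS]card_ord -cardsT -(cardsID [set k : 'I_n | W k <= x]%SET [set: _]).
rewrite addnC; apply: leq_add; apply: subset_leq_card; apply/fintype.subsetP => k; rewrite !inE//.
by rewrite andbT -ltNge => /andP[].
Qed.

(** Besides the points below both thresholds, the rank cutoffs admit only outliers of one coordinate
    or the other, at most n e of each. The second alternative of the hypotheses covers thresholds
    near or beyond 1, where a cutoff may exceed the count but few points lie to the right. *)
Lemma emp_subcopula_le x y (i j : int) (e : R) : (0 < n)%N -> 0 <= e ->
  (i <= (count U x)%:Z) || (1 - (count U x)%:R / n%:R <= e) ->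
  (j <= (count V y)%:Z) || (1 - (count V y)%:R / n%:R <= e) ->
  emp_subcopula n U V i j <= (joint x y)%:R / n%:R + 2 * e.
Proof.
move=> n0 e0 hx hy; rewrite emp_subcopulaE mulrC.
apply: (@le_trans _ _ ((joint x y)%:R / n%:R +
   (#|outlier U x i|%:R / n%:R + #|outlier V y j|%:R / n%:R))); last first.
  by rewrite lerD2l [2 * e]mulr_natl mulr2n lerD// card_outlier_le.
rewrite -!mulrDl ler_pM2r ?invr_gt0 ?ltr0n// -!natrD ler_nat.
apply: (@leq_trans #|[set k : 'I_n | (U k <= x) && (V k <= y)]
    :|: (outlier U x i :|: outlier V y j)|%SET); last first.
  rewrite (leq_trans (leq_card_setU _ _).1)// leq_add2l.
  exact: (leq_card_setU _ _).1.
apply: subset_leq_card; apply/fintype.subsetP => k; rewrite !inE => /andP[-> ->]/=.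
by case: leP => //=; case: leP; rewrite ?orbT.
Qed.

(* The rank transform is controlled by sandwiching: moving the evaluation point
   by [2 e] absorbs both the error of the marginal empirical distribution
   functions and the rounding to the grid. *)
Lemma emp_copula_approx (C : R -> R -> R) (u v e : R) : (0 < n)%N ->
  0 <= u <= 1 -> 0 <= v <= 1 -> n%:R^-1 <= e ->
  (forall x y, C (x + 2 * e) (y + 2 * e) <= C x y + 4 * e) ->
  (forall x y, 0 <= x -> 0 <= y -> C x y <= x /\ C x y <= y) ->
  let marg W x := `|(count W x)%:R / n%:R - Num.max 0 (Num.min 1 x)| <= e in
  let err x y := `|(joint x y)%:R / n%:R - C x y| <= e in
  marg U (u + 2 * e) -> marg V (v + 2 * e) -> err (u + 2 * e) (v + 2 * e) ->
  marg U (u - 2 * e) -> marg V (v - 2 * e) -> err (u - 2 * e) (v - 2 * e) ->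
  `|emp_copula n U V u v - C u v| <= 7 * e.
Proof.
move=> n0 /andP[u0 u1] /andP[v0 v1] ne Clip Cle marg err mU mV eU mU' mV' eU'.
have nn0 : 0 < n%:R :> R by rewrite ltr0n.
have e0 : 0 < e by rewrite (lt_le_trans _ ne)// invr_gt0.
have ne1 : 1 <= n%:R * e by rewrite -ler_pdivrMl// mulr1.
have /andP[El Eu] := emp_copula_between u v.
(* Below 1 the count is at least n (x + 2 e - e) = n x + n e, and n e >= 1 pays for rounding up.
   Beyond 1 the marginal is clamped and only the second alternative is available. *)
have up W x : 0 <= x -> marg W (x + 2 * e) ->
    (Num.floor (n%:R * x) + 1 <= (count W (x + 2 * e))%:Z) ||
    (1 - (count W (x + 2 * e))%:R / n%:R <= e).
  move=> x0; rewrite /marg ler_norml => /andP[h1 _].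
  have [x1|x1] := leP 1 (x + 2 * e).
    by rewrite (min_l x1) max_r// in h1; apply/orP; right; lra.
  rewrite (min_r (ltW x1)) max_r in h1; last by lra.
  apply/orP; left; rewrite -(ler_int R) intrD1.
  have h2 := @floor_le R (n%:R * x).
  apply: (le_trans (lerD h2 ne1)); rewrite -mulrDr mulrC -ler_pdivlMr//.
  by rewrite -pmulrn; lra.
(* Rounding down costs nothing: the count is an integer at most n x, hence at most the floor. *)
have lo W x : 0 <= x - 2 * e -> x <= 1 -> marg W (x - 2 * e) ->
    (count W (x - 2 * e))%:Z <= Num.floor (n%:R * x).
  move=> x0 x1; rewrite /marg min_r; last by lra.
  rewrite max_r// ler_norml => /andP[_ h1].
  rewrite floor_ge_int -pmulrn [leRHS]mulrC -ler_pdivrMr//; lra.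
have CL := Clip u v.
have CL' : C u v <= C (u - 2 * e) (v - 2 * e) + 4 * e.
  by have := Clip (u - 2 * e) (v - 2 * e); rewrite !subrK.
have hi := emp_subcopula_le n0 (ltW e0) (up _ _ u0 mU) (up _ _ v0 mV).
move: eU eU'; rewrite /err !ler_norml => /andP[f1 f2] /andP[f3 f4].
(* Upper side: 2 e from the outliers, e from the counts and 4 e from moving the point, hence 7 e.
   The lower side has no outliers and needs 5 e. *)
apply/andP; split; last by lra.
have E0 : 0 <= emp_copula n U V u v.
  by apply: le_trans El; rewrite emp_subcopulaE mulr_ge0// invr_ge0.
(* If a coordinate is below 2 e, the shifted point leaves the square, but then C u v <= 2 e and
   nonnegativity of the empirical copula suffices. *)
have [C1 C2] := Cle _ _ u0 v0.
have [u2|u2] := leP (2 * e) u; last by lra.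
have [v2|v2] := leP (2 * e) v; last by lra.
have u3 : 0 <= u - 2 * e by lra.
have v3 : 0 <= v - 2 * e by lra.
have low := emp_subcopula_ge (lo _ _ u3 u1 mU') (lo _ _ v3 v1 mV').
by lra.
Qed.

End empirical.

(** * Kernel means from cell masses *)

(* Instance resolution does not recover the measure structure from the bare function
   [lebesgue_measure]. *)
#[local] Instance ae_lebesgue_filter (R : realType) :
  Filter (nbhs (almost_everywhere (@lebesgue_measure R))).
Proof. exact: (ae_filter_ringOfSetsType (@lebesgue_measure R)). Qed.

Section finite_measure_integrals.
Context {d : measure_display} {T : measurableType d} {R : realType}.
Variables (m : {measure set T -> \bar R}) (D : set T).
Hypotheses (mD : measurable D) (Dfin : (m D < +oo)%E).

Lemma le_bound_integrable (f : T -> R) (M : R) : measurable_fun D f ->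
  (forall x, D x -> `|f x| <= M) -> m.-integrable D (EFin \o f).
Proof.
move=> mf fM; apply: measurable_bounded_integrable => //.
exists M; split; first exact: num_real.
by move=> M' MM' x Dx; apply: le_trans (fM _ Dx) (ltW MM').
Qed.

Lemma Rintegral_sum (I : Type) (r : seq I) (F : I -> T -> R) :
  (forall i, m.-integrable D (EFin \o F i)) ->
  \int[m]_(x in D) (\sum_(i <- r) F i x) = \sum_(i <- r) \int[m]_(x in D) F i x.
Proof.
move=> iF.
have iS s : m.-integrable D (EFin \o (fun x => \sum_(i <- s) F i x)).
  elim: s => [|i s IH].
    under eq_fun do rewrite big_nil.
    by apply: (@le_bound_integrable (cst 0) 0) => // x _; rewrite normr0.
  under eq_fun do rewrite big_cons.
  rewrite (_ : _ \o _ = (EFin \o F i) \+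
    (EFin \o (fun x => \sum_(j <- s) F j x)%R))%E; first exact: integrableD.
  by apply/funext => x /=; rewrite EFinD.
elim: r => [|i s IH].
  by under eq_Rintegral do rewrite big_nil; rewrite big_nil Rintegral_cst// mul0r.
under eq_Rintegral do rewrite big_cons.
by rewrite big_cons RintegralD// IH.
Qed.

Lemma Rintegral_close (f g : T -> R) (c : R) : 0 <= c ->
  m.-integrable D (EFin \o f) -> m.-integrable D (EFin \o g) ->
  (\forall x \ae m, D x -> `|f x - g x| <= c) ->
  `|\int[m]_(x in D) f x - \int[m]_(x in D) g x| <= c * fine (m D).
Proof.
move=> c0 iF iG fg; rewrite -RintegralB//.
have iFG : m.-integrable D (EFin \o (fun x => f x - g x)).
  rewrite (_ : _ \o _ = (EFin \o f) \- (EFin \o g))%E; first exact: integrableB.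
  by apply/funext => x /=; rewrite EFinB.
apply: (le_trans (le_normr_Rintegral _ _)) => //.
rewrite -Rintegral_cst// /Rintegral; apply: fine_le.
- by apply: integrable_fin_num => //; apply: integrable_norm.
- by rewrite integral_cst// fin_numM// ge0_fin_numE.
apply: ae_ge0_le_integral => //.
  apply/measurable_EFinP/measurableT_comp => //.
  by apply/measurable_EFinP; case/integrableP: iFG.
Qed.

End finite_measure_integrals.

Section partition_mean.
Context {R : realType}.

(** A bounded measurable function that is the identity on I: it replaces y under measures
    concentrated on I, and later makes the conditional mean locally integrable. *)
Definition trunc01 (y : R) : R := y * \1_I01 y.

Lemma measurable_I01 : measurable (@I01 R).
Proof.
by rewrite (_ : I01 = `[0, 1]%classic).
Qed.

Lemma measurable_trunc01 : measurable_fun [set: R] trunc01.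
Proof.
by apply: measurable_funM => //; apply: measurable_indic; exact: measurable_I01.
Qed.

Lemma trunc01_id y : I01 y -> trunc01 y = y.
Proof. by move=> y01; rewrite /trunc01 indicE mem_set// mulr1. Qed.

Lemma trunc01_ge0_le1 y : 0 <= trunc01 y <= 1.
Proof.
rewrite /trunc01 indicE; case: (boolP (y \in I01)) => [/set_mem|_].
  by rewrite /I01/= mulr1.
by rewrite mulr0 lexx ler01.
Qed.

Lemma norm_trunc01 y : `|trunc01 y| <= 1.
Proof. by have /andP[h0 h1] := trunc01_ge0_le1 y; rewrite ger0_norm. Qed.

Lemma mean_trunc01 (nu : {measure set R -> \bar R}) : nu (~` I01) = 0%E ->
  (\int[nu]_y y%:E = \int[nu]_y (trunc01 y)%:E)%E.
Proof.
move=> nu0; apply: ae_eq_integral => //.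
  by apply/measurable_EFinP; exact: measurable_trunc01.
exists (~` I01); split => //; first by apply: measurableC; exact: measurable_I01.
by move=> y /= h Iy; apply: h => _; rewrite trunc01_id.
Qed.

(** Replacing y by the midpoint of its cell costs at most half a cell width. The family [J] is
    general because it stands for open cells in the checkerboard and for half-open cells in the
    copula. *)
Lemma partition_mean (nu : {measure set R -> \bar R}) (N : nat) (J : nat -> set R) :
  (0 < N)%N -> nu setT = 1%E -> (forall j, measurable (J j)) ->
  (forall j y, J j y -> j%:R / N%:R <= y <= j.+1%:R / N%:R) ->
  trivIset setT J -> nu (~` \big[setU/set0]_(j < N) J j) = 0%E ->
  `|fine (\int[nu]_y y%:E) -
    \sum_(j < N) (j%:R + 1 / 2) / N%:R * fine (nu (J j))| <= (2 * N%:R)^-1.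
Proof.
move=> N0 nu1 mJ Jsub tJ nu0.
have N0' : 0 < N%:R :> R by rewrite ltr0n.
have mU : measurable (\big[setU/set0]_(j < N) J j) by exact: bigsetU_measurable.
have U01 y : (\big[setU/set0]_(j < N) J j) y -> I01 y.
  rewrite -bigcup_mkord => -[j /= jN /Jsub /andP[h1 h2]].
  rewrite /I01/= (le_trans _ h1) ?divr_ge0//= (le_trans h2)//.
  by rewrite ler_pdivrMr// mul1r ler_nat.
rewrite mean_trunc01; last first.
  apply: (subset_measure0 _ _ _ nu0); [|exact: measurableC|].
    by apply: measurableC; exact: measurable_I01.
  by apply: subsetC => y; exact: U01.
have fT : (nu setT < +oo)%E by rewrite nu1 ltry.
pose c (j : nat) : R := (j%:R + 1 / 2) / N%:R.
have iJ j : nu.-integrable setT (EFin \o (fun y => c j * \1_(J j) y)).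
  apply: (@le_bound_integrable _ _ _ _ _ _ _ _ `|c j|) => //.
    by apply: measurable_funM => //; exact: measurable_indic.
  by move=> y _; rewrite normrM ler_piMr// indicE; case: (_ \in _); rewrite ?normr1// normr0.
have -> : \sum_(j < N) c j * fine (nu (J j)) =
    \int[nu]_y (\sum_(j < N) c j * \1_(J j) y).
  rewrite Rintegral_sum//; apply: eq_bigr => j _.
  rewrite RintegralZl//; last first.
    apply: (@le_bound_integrable _ _ _ _ _ _ _ _ 1) => //.
    by move=> y _; rewrite indicE; case: (_ \in _); rewrite ?normr1// normr0.
  by rewrite /Rintegral integral_indic// setIT.
rewrite -[X in `|X - _|]/(\int[nu]_y trunc01 y).
have -> : (2 * N%:R)^-1 = (2 * N%:R)^-1 * fine (nu setT) by rewrite nu1 mulr1.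
apply: Rintegral_close => //.
- apply: (@le_bound_integrable _ _ _ _ _ _ _ _ 1) => //; first exact: measurable_trunc01.
  by move=> y _; exact: norm_trunc01.
- apply: (@le_bound_integrable _ _ _ _ _ _ _ _ (\sum_(j < N) `|c j|)) => //.
    apply: measurable_sum => j; apply: measurable_funM => //; exact: measurable_indic.
  move=> y _; rewrite (le_trans (ler_norm_sum _ _ _))// ler_sum// => j _.
  by rewrite normrM ler_piMr// indicE; case: (_ \in _); rewrite ?normr1// normr0.
exists (~` \big[setU/set0]_(j < N) J j); split => //; first exact: measurableC.
move=> y /= h Uy; apply: h => _.
rewrite trunc01_id; last exact: U01.
move: Uy; rewrite -bigcup_mkord => -[j /= jN Jy].
rewrite (bigD1 (Ordinal jN))//= big1 ?addr0 => [|i ij]; last first.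
  rewrite indicE memNset ?mulr0// => Jiy; move/eqP: ij; apply; apply: val_inj => /=.
  by apply: tJ => //; exists y.
rewrite indicE mem_set// mulr1 /c.
have /andP[h1 h2] := Jsub _ _ Jy.
have e1 : (2 * N%:R)^-1 = N%:R^-1 / 2 :> R by rewrite invfM mulrC.
rewrite e1 mulrDl; move: h2; rewrite -natr1 mulrDl => h2.
by rewrite ler_norml; apply/andP; split; lra.
Qed.

Lemma mean_I01 (nu : {measure set R -> \bar R}) : nu setT = 1%E ->
  nu (~` I01) = 0%E -> I01 (fine (\int[nu]_y y%:E)).
Proof.
move=> nu1 nu0; rewrite mean_trunc01//.
have fT : (nu setT < +oo)%E by rewrite nu1 ltry.
have it : nu.-integrable setT (EFin \o trunc01).
  apply: (@le_bound_integrable _ _ _ _ _ _ _ _ 1) => //; first exact: measurable_trunc01.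
  by move=> y _; exact: norm_trunc01.
rewrite /I01/= Rintegral_ge0/= => [|y _]; last by have /andP[] := trunc01_ge0_le1 y.
have -> : 1 = \int[nu]_y (cst 1 y) :> R by rewrite Rintegral_cst// nu1 mulr1.
apply: le_Rintegral => //.
  by apply: (@le_bound_integrable _ _ _ _ _ _ _ _ 1) => // y _; rewrite normr1.
by move=> y _; have /andP[] := trunc01_ge0_le1 y.
Qed.

End partition_mean.

Section cells.
Context {R : realType}.
Local Notation lambda := (@lebesgue_measure R).

(** Half-open, so that the cells tile ]0, 1] and their masses are exact differences of a
    distribution function; the checkerboard itself uses the open [cellI]. *)
Definition cellJ (N j : nat) : set R := `]j%:R / N%:R, j.+1%:R / N%:R]%classic.

Definition grid (N : nat) : set R := range (fun i : nat => i%:R / N%:R).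

Lemma cellI_itv N i : @cellI R N i = `]i%:R / N%:R, i.+1%:R / N%:R[%classic.
Proof. by apply/seteqP; split => x; rewrite /cellI/= in_itv. Qed.

Lemma measurable_cellI N i : measurable (@cellI R N i).
Proof. by rewrite cellI_itv. Qed.

Lemma cellI_sub_cellJ N i : cellI N i `<=` cellJ N i.
Proof. by move=> x /andP[h1 h2]; rewrite /cellJ/= in_itv/= h1 ltW. Qed.

Lemma cellJ_le N j y : cellJ N j y -> j%:R / N%:R <= y <= j.+1%:R / N%:R.
Proof. by rewrite /cellJ/= in_itv/= => /andP[/ltW -> ->]. Qed.

Lemma trivIset_cellJ N : trivIset setT (cellJ N).
Proof.
case: N => [|N] i j _ _ [x []]; rewrite /cellJ/= !in_itv/= => /andP[i1 i2] /andP[j1 j2].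
  (* For N = 0 both endpoints are 0, division by zero being 0, and the cells are empty. *)
  by move: i2 i1; rewrite !invr0 !mulr0 => /le_lt_trans h /h; rewrite ltxx.
have := lt_le_trans i1 j2; have := lt_le_trans j1 i2.
rewrite !ltr_pM2r ?invr_gt0// !ltr_nat !ltnS => ij ji.
by apply/eqP; rewrite eqn_leq ij ji.
Qed.

Lemma cellI_inj N i j (x : R) : cellI N i x -> cellI N j x -> i = j.
Proof.
move=> /cellI_sub_cellJ xi /cellI_sub_cellJ xj.
by apply: (@trivIset_cellJ N) => //; exists x.
Qed.

(** The boolean treats the open and the half-open cells at once. *)
Lemma lebesgue_cell (b : bool) N i : (0 < N)%N ->
  lambda [set` Interval (BRight (i%:R / N%:R)) (BSide b (i.+1%:R / N%:R))] =
  (N%:R^-1)%:E.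
Proof.
move=> N0; rewrite lebesgue_measure_itv/= lte_fin ltr_pM2r ?invr_gt0 ?ltr0n//.
by rewrite ltr_nat leqnn -EFinB -natr1 mulrDl mul1r addrAC subrr add0r.
Qed.

Lemma cellJ_I01 N i : (i < N)%N -> cellJ N i `<=` I01.
Proof.
move=> iN x /cellJ_le /andP[h1 h2]; rewrite /I01/= (le_trans _ h1) ?divr_ge0//=.
rewrite (le_trans h2)// ler_pdivrMr ?mul1r ?ler_nat//.
by rewrite ltr0n (leq_trans _ iN).
Qed.

Lemma grid_null N : lambda (grid N) = 0%E.
Proof.
by apply: countable_lebesgue_measure0; exact: card_image_le.
Qed.

Lemma exists_cellI N x : (0 < N)%N -> I01 x -> ~ grid N x ->
  exists2 i, (i < N)%N & cellI N i x.
Proof.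
move=> N0 /andP[x0 x1] ngrid.
have N0' : 0 < N%:R :> R by rewrite ltr0n.
have /truncn_itv/andP[h1 h2] : 0 <= N%:R * x by rewrite mulr_ge0// ltW.
set i := Num.truncn (N%:R * x) in h1 h2.
have h3 : i%:R / N%:R < x.
  rewrite lt_neqAle ler_pdivrMr// [leRHS]mulrC h1 andbT.
  by apply/negP => /eqP ix; apply: ngrid; exists i.
exists i.
  rewrite -(ltr_nat R) -(@ltr_pM2r _ N%:R^-1) ?invr_gt0// divff ?gt_eqF//.
  exact: lt_le_trans x1.
by rewrite /cellI/= h3 ltr_pdivlMr// mulrC.
Qed.

End cells.

(** * Conditional means of the checkerboard and of the copula *)

Section kernels.
Context {R : realType}.
Local Notation lambda := (@lebesgue_measure R).

Lemma I01_fin (B : set R) : measurable B -> B `<=` I01 -> (lambda B < +oo)%E.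
Proof.
move=> mB BI; apply: (@le_lt_trans _ _ (lambda `[0%R, 1%R]%classic)).
  by apply: le_measure; rewrite ?inE.
by rewrite lebesgue_measure_itv/= lte01 oppr0 addr0 ltry.
Qed.

Lemma I01_bound_integrable (B : set R) (f : R -> R) (M : R) :
  measurable B -> B `<=` I01 -> measurable_fun B f -> (forall x, `|f x| <= M) ->
  lambda.-integrable B (EFin \o f).
Proof.
move=> mB BI mf fM; apply: (@le_bound_integrable _ _ _ lambda _ _ _ _ M) => //.
exact: I01_fin.
Qed.

(** Uniqueness of densities: x |-> k x F and the constant have the same integral over every
    measurable subset of [B]. *)
Lemma kernel_ae_cst (m : set (R * R) -> \bar R) (k : R.-pker R ~> R)
    (B F : set R) (c : R) :
  markov_kernel_of m k -> measurable B -> measurable F -> B `<=` I01 ->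
  (forall E, E `<=` B -> measurable E -> m (E `*` F) = c%:E * lambda E)%E ->
  \forall x \ae lambda, B x -> k x F = c%:E.
Proof.
move=> km mB mF BI mc.
have : ae_eq lambda B (cst c%:E) (fun x => k x F).
  apply: integral_ae_eq => //.
  - apply: (@le_bound_integrable _ _ _ _ _ _ _ (cst c) `|c|) => //.
    exact: I01_fin.
  - by apply: measurable_funTS; exact: (measurable_kernel k F mF).
  - by move=> E EB mE; rewrite integral_cst// km// ?mc//; exact: subset_trans BI.
by apply: filterS => x h /h.
Qed.

(** No moment of [k x] is assumed, so the integral is treated through the positive and negative
    parts of y. *)
Lemma measurable_rfun (k : R.-pker R ~> R) : measurable_fun setT (rfun k).
Proof.
rewrite /rfun; apply: measurableT_comp => //.
under eq_fun do rewrite integralE.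
have mid : measurable_fun setT (EFin : R -> \bar R) by exact/measurable_EFinP.
apply: emeasurable_funB.
- apply: measurable_fun_integral_kernel => //.
  + by move=> U mU; exact: measurable_kernel.
  + exact: measurable_funepos.
- apply: measurable_fun_integral_kernel => //.
  + by move=> U mU; exact: measurable_kernel.
  + exact: measurable_funeneg.
Qed.

Lemma checkerboard_density_cell (D : R -> R -> R) N i j (p : R * R) :
  (i < N)%N -> (j < N)%N -> cellI N i p.1 -> cellI N j p.2 ->
  checkerboard_density D N p = N%:R ^+ 2 * cell_mass D N i j.
Proof.
move=> iN jN pi pj; rewrite /checkerboard_density; congr (_ * _).
rewrite (bigD1 (Ordinal iN))//= [X in _ + X]big1 ?addr0 => [|i' ii']; last first.
  apply: big1 => j' _; rewrite indicE memNset ?mulr0// => -[/= pi' _].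
  by move/eqP: ii'; apply; apply: val_inj; exact: cellI_inj pi' pi.
rewrite (bigD1 (Ordinal jN))//= [X in _ + X]big1 ?addr0 => [|j' jj']; last first.
  rewrite indicE memNset ?mulr0// => -[/= _ pj'].
  by move/eqP: jj'; apply; apply: val_inj; exact: cellI_inj pj' pj.
by rewrite indicE mem_set ?mulr1.
Qed.

Lemma checkerboard_density_out (D : R -> R -> R) N (p : R * R) :
  (~` \big[setU/set0]_(j < N) cellI N j) p.2 -> checkerboard_density D N p = 0.
Proof.
move=> h; rewrite /checkerboard_density big1 ?mulr0// => i _; apply: big1 => j _.
rewrite indicE memNset ?mulr0// => -[/= _ pj]; apply: h.
by rewrite -bigcup_mkord; exists j => //=.
Qed.

Lemma checkerboard_cell (D : R -> R -> R) N i j (E : set R) :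
  (i < N)%N -> (j < N)%N -> measurable E -> E `<=` cellI N i ->
  checkerboard_measure D N (E `*` cellI N j) =
  ((N%:R * cell_mass D N i j)%:E * lambda E)%E.
Proof.
move=> iN jN mE EI; have N0 : (0 < N)%N by exact: leq_trans iN.
rewrite /checkerboard_measure.
rewrite (eq_integral (cst (N%:R ^+ 2 * cell_mass D N i j)%:E)); last first.
  move=> p /set_mem[/= /EI pi pj]; congr EFin.
  exact: checkerboard_density_cell.
have mI := @measurable_cellI R N j.
rewrite integral_cst; last exact: measurableX.
have mEI := product_measure1E lambda lambda mE mI.
have lI : lambda (cellI N j) = (N%:R^-1)%:E by rewrite cellI_itv lebesgue_cell.
transitivity ((N%:R ^+ 2 * cell_mass D N i j)%:E * (lambda E * (N%:R^-1)%:E))%E.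
  by rewrite -lI; congr (_ * _)%E; exact: mEI.
rewrite muleCA muleC -EFinM; congr (_ * _)%E; congr EFin.
by field; rewrite pnatr_eq0 -lt0n.
Qed.

Lemma checkerboard_out (D : R -> R -> R) N (E : set R) :
  checkerboard_measure D N (E `*` ~` \big[setU/set0]_(j < N) cellI N j) = 0%E.
Proof.
rewrite /checkerboard_measure integral0_eq// => p [_ /= h].
by rewrite checkerboard_density_out.
Qed.

(** Over the i-th strip the kernel gives the constant N m_ij to the j-th cell, and nothing to the
    complement of the open cells, where the density vanishes. The total mass one comes from [k]
    being a probability kernel, so [D] can be any function. *)
Lemma checkerboard_rfun (D : R -> R -> R) N (k : R.-pker R ~> R) :
  (0 < N)%N -> markov_kernel_of (checkerboard_measure D N) k ->
  \forall x \ae lambda, forall i, (i < N)%N -> cellI N i x ->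
    I01 (rfun k x) /\
    `|rfun k x - \sum_(j < N) (j%:R + 1 / 2) * cell_mass D N i j| <= (2 * N%:R)^-1.
Proof.
move=> N0 kD.
have mU : measurable (\big[setU/set0]_(j < N) @cellI R N j).
  by apply: bigsetU_measurable => j _; exact: measurable_cellI.
have IsubI01 i : (i < N)%N -> @cellI R N i `<=` I01.
  by move=> iN; apply: subset_trans (cellJ_I01 iN); exact: cellI_sub_cellJ.
have h0 i j : (i < N)%N -> (j < N)%N -> \forall x \ae lambda,
    cellI N i x -> k x (cellI N j) = (N%:R * cell_mass D N i j)%:E.
  move=> iN jN; apply: (kernel_ae_cst kD); try exact: measurable_cellI.
    exact: IsubI01.
  by move=> E EI mE; exact: checkerboard_cell.
have h1 : \forall x \ae lambda, forall i j, (i < N)%N -> (j < N)%N ->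
    cellI N i x -> k x (cellI N j) = (N%:R * cell_mass D N i j)%:E.
  apply: ae_foralln => i; apply: ae_foralln => j.
  have [iN|] := boolP (i < N)%N; last by move=> _; exact: aeW.
  have [jN|] := boolP (j < N)%N; last by move=> _; exact: aeW.
  by have [A [mA A0 hA]] := h0 _ _ iN jN; exists A; split => // x hx; apply: hA => h;
    apply: hx => _ _.
have h2 : \forall x \ae lambda, I01 x ->
    k x (~` \big[setU/set0]_(j < N) cellI N j) = 0%E.
  apply: (kernel_ae_cst kD) => //; [exact: measurable_I01|exact: measurableC|].
  by move=> E EI mE; rewrite checkerboard_out mul0e.
move: h1 h2; apply: filterS2 => x h1 h2 i iN xi.
have k0 := h2 (IsubI01 _ iN _ xi).
split.
  apply: mean_I01; first exact: prob_kernel.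
  apply: (subset_measure0 _ _ _ k0); [|exact: measurableC|].
    by apply: measurableC; exact: measurable_I01.
  by apply: subsetC => y; rewrite -bigcup_mkord => -[j /= jN]; exact: IsubI01.
have tI : trivIset setT (@cellI R N).
  by move=> j j' _ _ [y [yj yj']]; exact: cellI_inj yj yj'.
have <- : \sum_(j < N) (j%:R + 1 / 2) / N%:R * fine (k x (cellI N j)) =
    \sum_(j < N) (j%:R + 1 / 2) * cell_mass D N i j.
  apply: eq_bigr => j _; rewrite (h1 i)// mulrA; congr (_ * _).
  by rewrite divfK// pnatr_eq0 -lt0n.
apply: partition_mean => //; first exact: prob_kernel.
- by move=> j; exact: measurable_cellI.
- by move=> j y yj; apply: cellJ_le; exact: cellI_sub_cellJ.
Qed.

(** Within I the points outside the cells are grid points, null for the second marginal; integrating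
    the kernel over subsets of I carries this to almost every x. *)
Lemma copula_kernel_null (mu : probability (R * R)%type R) (k : R.-pker R ~> R) N :
  (0 < N)%N -> is_copula_measure mu -> markov_kernel_of mu k ->
  \forall x \ae lambda, I01 x -> k x (~` \big[setU/set0]_(j < N) cellJ N j) = 0%E.
Proof.
move=> N0 [_ muV] kmu.
have mU : measurable (~` \big[setU/set0]_(j < N) @cellJ R N j).
  by apply: measurableC; apply: bigsetU_measurable => j _; exact: measurable_itv.
apply: (kernel_ae_cst kmu) => //; first exact: measurable_I01.
move=> E EI mE; rewrite mul0e.
apply: (@subset_measure0 _ _ _ mu _ (setT `*` (~` \big[setU/set0]_(j < N) cellJ N j))).
- exact: measurableX.
- exact: measurableX.
- by move=> p [].
apply: etrans (muV _ mU) _; apply: (@subset_measure0 _ _ _ lambda _ (grid N)).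
- by apply: measurableI => //; exact: measurable_I01.
- by apply: countable_measurable => //; exact: card_image_le.
- move=> y [hy yI]; apply: contrapT => /(exists_cellI N0 yI)[j jN yj]; apply: hy.
  by rewrite -bigcup_mkord; exists j => //; exact: cellI_sub_cellJ.
- exact: grid_null.
Qed.

Lemma copula_rfun_I01 (mu : probability (R * R)%type R) (k : R.-pker R ~> R) :
  is_copula_measure mu -> markov_kernel_of mu k ->
  \forall x \ae lambda, I01 x -> I01 (rfun k x).
Proof.
(* For N = 1 the only cell is ]0, 1], so the kernel is concentrated on I. *)
move=> hmu kmu; have := copula_kernel_null (ltn0Sn 0) hmu kmu.
apply: filterS => x /[apply] k0; apply: mean_I01; first exact: prob_kernel.
apply: (subset_measure0 _ _ _ k0).
- by apply: measurableC; exact: measurable_I01.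
- by apply: measurableC; apply: bigsetU_measurable => j _; exact: measurable_itv.
- by apply: subsetC; rewrite big_ord_recl big_ord0 setU0; exact: cellJ_I01.
Qed.

(** The midpoint approximation, valid at almost every x, is integrated over the i-th cell: by the
    defining identity of the kernel, [k x (cellJ N j)] integrates to the mass of the product cell,
    and the factor N turns the integral into an average. *)
Lemma copula_rfun_avg (mu : probability (R * R)%type R) (k : R.-pker R ~> R) N i :
  (i < N)%N -> is_copula_measure mu -> markov_kernel_of mu k ->
  `|N%:R * \int[lambda]_(x in cellJ N i) trunc01 (rfun k x) -
    \sum_(j < N) (j%:R + 1 / 2) * fine (mu (cellJ N i `*` cellJ N j))| <= (2 * N%:R)^-1.
Proof.
move=> iN hmu kmu; have N0 : (0 < N)%N by exact: leq_trans iN.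
have N0' : 0 < N%:R :> R by rewrite ltr0n.
have mJ j : measurable (@cellJ R N j) by exact: measurable_itv.
have JI := @cellJ_I01 R _ _ iN.
have Jfin := I01_fin (mJ i) JI.
have mk j : measurable_fun (@cellJ R N i) (fun x => fine (k x (cellJ N j))).
  apply: measurable_funTS; apply: measurableT_comp => //.
  exact: measurable_kernel.
have k1 j x : `|fine (k x (cellJ N j))| <= 1.
  rewrite ger0_norm ?fine_ge0// -lee_fin fineK.
    by rewrite -(prob_kernel (s := k) x) le_measure ?inE.
  rewrite ge0_fin_numE// (@le_lt_trans _ _ 1%E) ?ltry//.
  by rewrite -(prob_kernel (s := k) x) le_measure ?inE.
have ik j : lambda.-integrable (cellJ N i) (EFin \o (fun x => fine (k x (cellJ N j)))).
  exact: (@I01_bound_integrable _ _ 1).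
pose c (j : nat) : R := (j%:R + 1 / 2) / N%:R.
have ick j : lambda.-integrable (cellJ N i)
    (EFin \o (fun x => c j * fine (k x (cellJ N j)))).
  apply: (@I01_bound_integrable _ _ `|c j|) => //; first exact: measurable_funM.
  by move=> x; rewrite normrM ler_piMr.
have iS : lambda.-integrable (cellJ N i)
    (EFin \o (fun x => \sum_(l < N) c l * fine (k x (cellJ N l)))).
  apply: (@I01_bound_integrable _ _ (\sum_(l < N) `|c l|)) => //.
    by apply: measurable_sum => l; exact: measurable_funM.
  move=> x; rewrite (le_trans (ler_norm_sum _ _ _))// ler_sum// => l _.
  by rewrite normrM ler_piMr.
have ir : lambda.-integrable (cellJ N i) (EFin \o (fun x => trunc01 (rfun k x))).
  apply: (@I01_bound_integrable _ _ 1) => //.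
    apply: measurable_funTS; apply: measurableT_comp; first exact: measurable_trunc01.
    exact: measurable_rfun.
  by move=> x; exact: norm_trunc01.
have intk j : \int[lambda]_(x in cellJ N i) fine (k x (cellJ N j)) =
    fine (mu (cellJ N i `*` cellJ N j)).
  rewrite /Rintegral -kmu//; congr fine; apply: eq_integral => x _.
  rewrite fineK// ge0_fin_numE// (@le_lt_trans _ _ 1%E) ?ltry//.
  by rewrite -(prob_kernel (s := k) x) le_measure ?inE.
have -> : \sum_(j < N) (j%:R + 1 / 2) * fine (mu (cellJ N i `*` cellJ N j)) =
    N%:R * \int[lambda]_(x in cellJ N i) (\sum_(j < N) c j * fine (k x (cellJ N j))).
  rewrite Rintegral_sum; [|exact: mJ|exact: Jfin|by move=> l; exact: ick].
  rewrite mulr_sumr; apply: eq_bigr => j _.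
  rewrite RintegralZl; [|exact: mJ|exact: ik].
  by rewrite intk mulrA /c mulrCA divff ?mulr1// gt_eqF.
rewrite -mulrBr normrM (ger0_norm (ltW N0')).
have lJ : fine (lambda (cellJ N i)) = N%:R^-1 :> R by rewrite /cellJ lebesgue_cell.
have -> : (2 * N%:R)^-1 = N%:R * ((2 * N%:R)^-1 * fine (lambda (cellJ N i))) :> R.
  by rewrite lJ mulrCA divff ?mulr1// gt_eqF.
rewrite ler_pM2l//.
apply: Rintegral_close; [exact: mJ|exact: Jfin| |exact: ir|exact: iS|].
  by rewrite invr_ge0 mulr_ge0.
have := copula_rfun_I01 hmu kmu; have := copula_kernel_null N0 hmu kmu.
apply: filterS2 => x k0 r01 xJ; rewrite trunc01_id; last by apply: r01; exact: JI.
exact: (partition_mean N0 (prob_kernel x) mJ (@cellJ_le R N) (@trivIset_cellJ R N)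
  (k0 (JI _ xJ))).
Qed.

End kernels.

(** * The limit *)

(** Each summand is (j+1) d_(j+1) - j d_j minus the trapezoid (d_j + d_(j+1)) / 2. The first part
    telescopes to n d_n, without a term at 0, and both parts are at most n e. *)
Lemma abel_midpoint_bound (R : realFieldType) (d : nat -> R) (e : R) (n : nat) :
  (forall j, (j <= n)%N -> `|d j| <= e) ->
  `|\sum_(j < n) (j%:R + 1 / 2) * (d j.+1 - d j)| <= 2 * n%:R * e.
Proof.
move=> de.
have -> : \sum_(j < n) (j%:R + 1 / 2) * (d j.+1 - d j) =
    n%:R * d n - \sum_(j < n) (d j + d j.+1) / 2.
  elim: {de} n => [|n IH]; first by rewrite !big_ord0 mul0r subrr.
  by rewrite !big_ord_recr/= IH -natr1; field.
have h1 : `|n%:R * d n| <= n%:R * e by rewrite normrM ger0_norm// ler_wpM2l// de.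
have h2 : `|\sum_(j < n) (d j + d j.+1) / 2| <= n%:R * e.
  apply: (le_trans (ler_norm_sum _ _ _)).
  rewrite -[in leRHS](card_ord n) mulr_natl -sumr_const; apply: ler_sum => j _.
  rewrite normrM (ger0_norm (_ : 0 <= 2^-1))// ler_pdivrMr//.
  have := de j (ltnW (ltn_ord j)); have := de j.+1 (ltn_ord j).
  by have := ler_normD (d j) (d j.+1); lra.
by rewrite (le_trans (ler_normB _ _))//; lra.
Qed.

(** * The distribution function of the copula measure *)

Section copula_cdf.
Context {R : realType}.
Variable mu : probability (R * R)%type R.
Hypothesis hmu : is_copula_measure mu.

(** Quadrants in the whole plane, since the shifted evaluation points may leave the unit square. *)
Definition quadrant (x y : R) : set (R * R) := `]-oo, x]%classic `*` `]-oo, y]%classic.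

Definition copula_cdf (x y : R) : R := fine (mu (quadrant x y)).

Lemma measurable_quadrant x y : measurable (quadrant x y).
Proof. exact: measurableX. Qed.

Let muK A : measurable A -> (fine (mu A))%:E = mu A.
Proof. by move=> mA; rewrite fineK// fin_num_measure. Qed.

Let fst_marginal (A : set R) : measurable A ->
  mu (A `*` setT) = lebesgue_measure (A `&` I01).
Proof. by case: hmu => h _ /h. Qed.

Let snd_marginal (A : set R) : measurable A ->
  mu (setT `*` A) = lebesgue_measure (A `&` I01).
Proof. by case: hmu => _ h /h. Qed.

Let lebesgue_itv_le (a b : R) : a <= b ->
  (lebesgue_measure (`]a, b]%classic `&` I01) <= (b - a)%:E)%E.
Proof.
move=> ab; apply: (@le_trans _ _ (lebesgue_measure `]a, b]%classic)).
  apply: le_measure; rewrite ?inE//.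
  by apply: measurableI => //; exact: measurable_I01.
by rewrite lebesgue_measure_itv/= lte_fin; case: ifP => // _; rewrite lee_fin subr_ge0.
Qed.

Let lebesgue_Iic x : lebesgue_measure (`]-oo, x]%classic `&` I01) =
  (Num.max 0 (Num.min 1 x))%:E :> \bar R.
Proof.
have -> : `]-oo, x]%classic `&` I01 = `[0, Num.min 1 x]%classic :> set R.
  apply/seteqP; split => y /=; rewrite /I01/= !in_itv/= le_min.
    by move=> [yx /andP[-> ->]].
  by move=> /and3P[-> -> ->].
by rewrite lebesgue_measure_itv/= lte_fin; case: ltP => // h; rewrite -EFinB subr0.
Qed.

Lemma copula_fst_marginal x :
  fine (mu (`]-oo, x]%classic `*` setT)) = Num.max 0 (Num.min 1 x).
Proof. by rewrite fst_marginal// lebesgue_Iic. Qed.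

Lemma copula_snd_marginal x :
  fine (mu (setT `*` `]-oo, x]%classic)) = Num.max 0 (Num.min 1 x).
Proof. by rewrite snd_marginal// lebesgue_Iic. Qed.

Lemma copula_cdf_le x y : 0 <= x -> 0 <= y ->
  copula_cdf x y <= x /\ copula_cdf x y <= y.
Proof.
move=> x0 y0; have mq := measurable_quadrant x y.
have clamp (z : R) : 0 <= z -> Num.max 0 (Num.min 1 z) <= z.
  by move=> z0; rewrite ge_max z0 ge_min lexx orbT.
split.
- apply: le_trans (clamp _ x0); rewrite -copula_fst_marginal.
  apply: fine_le; rewrite ?fin_num_measure//; first exact: measurableX.
  by apply: le_measure; rewrite ?inE//; [exact: measurableX|move=> p []].
- apply: le_trans (clamp _ y0); rewrite -copula_snd_marginal.
  apply: fine_le; rewrite ?fin_num_measure//; first exact: measurableX.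
  by apply: le_measure; rewrite ?inE//; [exact: measurableX|move=> p []].
Qed.

(** The larger quadrant is covered by the smaller one and two strips of width h, each of mass at
    most h by uniformity of the marginals. *)
Lemma copula_cdf_lip x y h : 0 <= h ->
  copula_cdf (x + h) (y + h) <= copula_cdf x y + 2 * h.
Proof.
move=> h0.
have mA : measurable (`]x, x + h]%classic `*` setT : set (R * R)) by exact: measurableX.
have mB : measurable (setT `*` `]y, y + h]%classic : set (R * R)) by exact: measurableX.
have mq a b := measurable_quadrant a b.
rewrite -lee_fin EFinD !muK// (_ : 2 * h = h + h); last by ring.
apply: (@le_trans _ _ (mu (quadrant x y `|`
    (`]x, x + h]%classic `*` setT `|` setT `*` `]y, y + h]%classic)))).
  apply: le_measure; rewrite ?inE.
  - exact: mq.
  - exact: (measurableU _ _ (mq _ _) (measurableU _ _ mA mB)).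
  move=> [a b] [/=]; rewrite !in_itv/= => ax bY.
  have [ax'|ax'] := leP a x; last by right; left; split => //=; rewrite in_itv/= ax'.
  have [by'|by'] := leP b y; last by right; right; split => //=; rewrite in_itv/= by'.
  by left; split; rewrite /= in_itv.
apply: (le_trans (measureU2 _ (mq _ _) (measurableU _ _ mA mB))).
apply: leeD2l; apply: (le_trans (measureU2 _ mA mB)).
have itv (z : R) : (lebesgue_measure (`]z, (z + h)%R]%classic `&` I01) <= h%:E)%E.
  by have := @lebesgue_itv_le z (z + h); rewrite lerDl h0 addrAC subrr add0r; apply.
rewrite EFinD; apply: leeD.
- by apply: (le_trans _ (itv x)); rewrite -fst_marginal.
- by apply: (le_trans _ (itv y)); rewrite -snd_marginal.
Qed.

Let Iic_split (a b : R) : a <= b ->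
  `]-oo, b]%classic = `]-oo, a]%classic `|` `]a, b]%classic :> set R.
Proof.
move=> ab; apply/seteqP; split => y /=; rewrite !in_itv/=.
  by move=> yb; have [ya|ya] := leP y a; [left|right].
by move=> [ya|/andP[]//]; exact: le_trans ab.
Qed.

Let Iic_disj (a b y : R) : `]-oo, a]%classic y -> `]a, b]%classic y -> False.
Proof. by rewrite /= !in_itv/= => ya /andP[ay _]; move: ay; rewrite ltNge ya. Qed.

Let fst_split (a b : R) (S : set R) : a <= b -> measurable S ->
  fine (mu (`]a, b]%classic `*` S)) =
  fine (mu (`]-oo, b]%classic `*` S)) - fine (mu (`]-oo, a]%classic `*` S)).
Proof.
move=> ab mS; rewrite (Iic_split ab).
rewrite (_ : (_ `|` _) `*` S = `]-oo, a]%classic `*` S `|` `]a, b]%classic `*` S); last first.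
  apply/seteqP; split => -[p q] /=; first by move=> [[?|?] ?]; [left|right].
  by move=> [[? ?]|[? ?]]; split => //; [left|right].
rewrite measureU; try exact: measurableX.
  rewrite fineD ?fin_num_measure//; try exact: measurableX.
  by rewrite addrAC subrr add0r.
by apply/seteqP; split => // -[p q] [[/= h1 _] [/= h2 _]]; exact: Iic_disj h1 h2.
Qed.

Let snd_split (a b : R) (S : set R) : a <= b -> measurable S ->
  fine (mu (S `*` `]a, b]%classic)) =
  fine (mu (S `*` `]-oo, b]%classic)) - fine (mu (S `*` `]-oo, a]%classic)).
Proof.
move=> ab mS; rewrite (Iic_split ab).
rewrite (_ : S `*` (_ `|` _) = S `*` `]-oo, a]%classic `|` S `*` `]a, b]%classic); last first.
  apply/seteqP; split => -[p q] /=; first by move=> [? [?|?]]; [left|right].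
  by move=> [[? ?]|[? ?]]; split => //; [left|right].
rewrite measureU; try exact: measurableX.
  rewrite fineD ?fin_num_measure//; try exact: measurableX.
  by rewrite addrAC subrr add0r.
by apply/seteqP; split => // -[p q] [[/= _ h1] [/= _ h2]]; exact: Iic_disj h1 h2.
Qed.

Lemma copula_cell_mass N i j :
  fine (mu (cellJ N i `*` cellJ N j)) = cell_mass copula_cdf N i j.
Proof.
have le_cell k : k%:R / N%:R <= k.+1%:R / N%:R :> R by rewrite ler_wpM2r// ler_nat.
rewrite /cellJ fst_split// !snd_split//.
by rewrite /cell_mass /copula_cdf /quadrant; ring.
Qed.

End copula_cdf.

(** * Powers of n, the sequence N(n), and differentiation along cells *)

Section limits.
Context {R : realType}.

Lemma powRVK (a x : R) : 0 < a -> 0 <= x -> (x `^ a^-1) `^ a = x.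
Proof. by move=> a0 x0; rewrite -powRrM mulVf ?gt_eqF// powRr1. Qed.

Lemma powR_nat_pinfty (a M : R) : 0 < a -> \forall n \near \oo, M <= n%:R `^ a.
Proof.
move=> a0; near=> n.
have h : (Num.max M 1) `^ a^-1 <= n%:R by near: n; exact: nbhs_infty_ger.
have m0 : 0 <= Num.max M 1 by rewrite le_max ler01 orbT.
apply: (@le_trans _ _ (Num.max M 1)); first by rewrite le_max lexx.
rewrite -[leLHS](powRVK a0)//.
by apply: ge0_ler_powR => //; rewrite ?nnegrE ?powR_ge0 ?(ltW a0).
Unshelve. all: by end_near. Qed.

Lemma powR_nat_cvg0 (a : R) : 0 < a -> (fun n : nat => n%:R `^ (- a)) @ \oo --> 0.
Proof.
move=> a0; apply/cvgrPdist_le => e e0; near=> n.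
rewrite sub0r normrN ger0_norm ?powR_ge0// powRN -[leRHS]invrK.
have h : e^-1 <= n%:R `^ a by near: n; exact: powR_nat_pinfty.
by rewrite lef_pV2// posrE ?invr_gt0// (lt_le_trans _ h)// invr_gt0.
Unshelve. all: by end_near. Qed.

Lemma powR_seq_cvg0 (q : R) (u : nat -> R) : 0 < q -> (forall n, 0 <= u n) ->
  u @ \oo --> 0 -> (fun n => u n `^ q) @ \oo --> 0.
Proof.
move=> q0 u0 /cvgrPdist_le u_0; apply/cvgrPdist_le => e e0.
have e1 : 0 < e `^ q^-1 by rewrite powR_gt0.
near=> n; have : `|0 - u n| <= e `^ q^-1 by near: n; exact: u_0.
rewrite !sub0r !normrN !ger0_norm ?powR_ge0// => un.
rewrite -[leRHS](powRVK q0 (ltW e0)).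
by apply: ge0_ler_powR => //; rewrite ?nnegrE ?powR_ge0 ?(ltW q0).
Unshelve. all: by end_near. Qed.

(** The index is shifted from here on because for s > 0 there are no cells at n = 0. *)
Lemma Nseq_gt0 (s : R) n : 0 <= s -> (0 < Nseq s n.+1)%N.
Proof.
move=> s0; rewrite /Nseq truncn_gt0 -[leLHS](powRr0 n.+1%:R).
by rewrite ler_powR// ler1n.
Qed.

Lemma Nseq_powR (s : R) n : (Nseq s n)%:R <= n%:R `^ s.
Proof. by rewrite /Nseq truncn_le powR_ge0. Qed.

Lemma Nseq_le (s : R) n : s <= 1 -> (Nseq s n.+1 <= n.+1)%N.
Proof.
move=> s1; rewrite -(ler_nat R) (le_trans (Nseq_powR _ _))//.
by rewrite ler1_powR// ler1n.
Qed.

Lemma Nseq_inv_cvg0 (s : R) : 0 < s ->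
  (fun n => (Nseq s n.+1)%:R^-1 : R) @ \oo --> 0.
Proof.
move=> s0; apply/cvgrPdist_le => e e0.
have [M _ HM] := powR_nat_pinfty (e^-1 + 1) s0.
exists M => // n /= Mn; rewrite sub0r normrN ger0_norm ?invr_ge0//.
have h : e^-1 + 1 <= n.+1%:R `^ s by apply: HM; exact: leqW.
have h2 : n.+1%:R `^ s < (Nseq s n.+1).+1%:R by exact: truncnS_gt.
have N0 : 0 < (Nseq s n.+1)%:R :> R by rewrite ltr0n Nseq_gt0// ltW.
rewrite -[leRHS]invrK lef_pV2 ?posrE ?invr_gt0//.
have h3 : (Nseq s n.+1).+1%:R = (Nseq s n.+1)%:R + 1 :> R by rewrite natr1.
by move: h2; rewrite h3; lra.
Qed.

(** The cells are not centred at [x], but each fills a fixed fraction of a ball around [x], which is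
    enough for Lebesgue differentiation. *)
Lemma lebesgue_diff_cells (f : R -> R) (x : R) (N i : nat -> nat) :
  locally_integrable setT f -> lebesgue_pt f x -> (forall n, (0 < N n)%N) ->
  (forall n, cellJ (N n) (i n) x) -> (fun n => (N n)%:R^-1 : R) @ \oo --> 0 ->
  (fun n => (N n)%:R * \int[lebesgue_measure]_(y in cellJ (N n) (i n)) f y)
    @ \oo --> f x.
Proof.
move=> locf fx N0 xN Ncvg.
have Np n : 0 < (N n)%:R :> R by rewrite ltr0n.
pose a n : R := (i n)%:R / (N n)%:R; pose b n : R := (i n).+1%:R / (N n)%:R.
have ab n : b n = a n + (N n)%:R^-1 by rewrite /b -natr1 mulrDl mul1r.
(* The differentiation theorem wants a shrinking family at every point [y], so the cells around [x]
   are translated by y - x. *)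
pose E (y : R) n := `]a n - x + y, b n - x + y]%classic.
have muE y n : lebesgue_measure (E y n) = ((N n)%:R^-1)%:E.
  rewrite /E lebesgue_measure_itv/= lte_fin ltrD2r ltrD2r ab ltrDl invr_gt0 Np.
  by rewrite -EFinB; congr EFin; ring.
have nice y : nicely_shrinking y (E y).
  split; first by move=> n; exact: measurable_itv.
  have r0 n : 0 < 2 * (N n)%:R^-1 :> R by rewrite mulr_gt0 ?invr_gt0.
  (* A ball of radius 2 / N contains the cell and has length 4 / N, four times that of the cell. *)
  exists (4, fun n => PosNum (r0 n)); split => //=.
  - by rewrite -[X in _ --> X](mulr0 2); apply: cvgMr.
  - move=> n z; rewrite /E/= in_itv/= => /andP[h1 h2].
    have := xN n; rewrite /cellJ/= in_itv/= -/(a n) -/(b n) => /andP[ax xb].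
    have n0 : 0 < (N n)%:R^-1 :> R by rewrite invr_gt0.
    rewrite /ball/= ltr_norml; move: h1 h2 ax xb (ab n) => h1 h2 ax xb abn.
    by apply/andP; split; lra.
  - move=> n; rewrite lebesgue_measure_ball; last exact: ltW.
    by rewrite muE -EFinM lee_fin/=; lra.
have := nice_lebesgue_differentiation nice locf fx.
have Ex n : E x n = cellJ (N n) (i n) by rewrite /E /cellJ !subrK.
move/fine_cvgP => [_]; apply: cvg_trans; apply: near_eq_cvg; apply: nearW => n /=.
rewrite muE Ex inver gt_eqF ?invr_gt0// invrK.
have ifin : (\int[lebesgue_measure]_(y in cellJ (N n) (i n)) (f y)%:E)%E \is a fin_num.
  apply: integrable_fin_num; first exact: measurable_itv.
  case: locf => mf _ lf; apply/integrableP; split.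
    by apply/measurable_EFinP; exact: measurable_funTS.
  apply: (@le_lt_trans _ _ (\int[lebesgue_measure]_(y in `[a n, b n]) `|(f y)%:E|)%E).
    apply: ge0_subset_integral => //.
      exact: measurable_itv.
      apply: measurableT_comp => //; apply/measurable_EFinP.
      exact: measurable_funTS.
    by move=> y; rewrite /cellJ/= !in_itv/= => /andP[/ltW -> ->].
  by apply: lf => //; exact: segment_compact.
by rewrite fineM.
Qed.

End limits.

(** A cell mass is a second difference: summation by parts handles the j-direction, and the
    difference of the errors on two adjacent grid lines in the i-direction is at most 2 e, hence 2 N
    (2 e). *)
Lemma cell_mass_sum_close (R : realType) (E C : R -> R -> R) (N i : nat) (e : R) :
  (i < N)%N ->
  (forall k j, (k <= N)%N -> (j <= N)%N ->
    `|E (k%:R / N%:R) (j%:R / N%:R) - C (k%:R / N%:R) (j%:R / N%:R)| <= e) ->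
  `|\sum_(j < N) (j%:R + 1 / 2) * cell_mass E N i j -
    \sum_(j < N) (j%:R + 1 / 2) * cell_mass C N i j| <= 4 * N%:R * e.
Proof.
move=> iN EC.
pose g k j := E (k%:R / N%:R) (j%:R / N%:R) - C (k%:R / N%:R) (j%:R / N%:R).
pose d j := g i.+1 j - g i j.
have -> : \sum_(j < N) (j%:R + 1 / 2) * cell_mass E N i j -
    \sum_(j < N) (j%:R + 1 / 2) * cell_mass C N i j =
    \sum_(j < N) (j%:R + 1 / 2) * (d j.+1 - d j).
  by rewrite -sumrB; apply: eq_bigr => j _; rewrite /d /g /cell_mass; ring.
have -> : 4 * N%:R * e = 2 * N%:R * (2 * e) by ring.
apply: abel_midpoint_bound => j jN.
have := EC _ _ (ltnW iN) jN; have := EC _ _ iN jN; rewrite -/(g i j) -/(g i.+1 j).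
by have := ler_normB (g i.+1 j) (g i j); rewrite /d; lra.
Qed.

(** * Uniform error of the empirical copula on the grid *)

Section sample.
Context {R : realType} {d : measure_display} {T : measurableType d}.
Variables (P : probability T R) (X : nat -> T -> (R * R)%type).
Variable mu : probability (R * R)%type R.
Hypotheses (iidX : iid_with P X mu) (hmu : is_copula_measure mu).

Let U (w : T) k := (X k w).1.
Let V (w : T) k := (X k w).2.

Lemma freq_count_quadrant n x y w : freq_count X n (quadrant x y) w =
  #|[set k : 'I_n | (U w k <= x) && (V w k <= y)]%SET|.
Proof.
apply: eq_card => k; rewrite !inE in_setX.
by congr (_ && _); apply/idP/idP; rewrite inE/= in_itv.
Qed.

Lemma freq_count_fst n x w : freq_count X n (`]-oo, x]%classic `*` setT) w =
  #|[set k : 'I_n | U w k <= x]%SET|.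
Proof.
apply: eq_card => k; rewrite !inE in_setX in_setT andbT.
by apply/idP/idP; rewrite inE/= in_itv.
Qed.

Lemma freq_count_snd n x w : freq_count X n (setT `*` `]-oo, x]%classic) w =
  #|[set k : 'I_n | V w k <= x]%SET|.
Proof.
apply: eq_card => k; rewrite !inE in_setX in_setT andTb.
by apply/idP/idP; rewrite inE/= in_itv.
Qed.

Lemma emp_copula_near (s t : R) : 0 < s -> s < t -> t < 1 / 2 ->
  \forall w \ae P, \forall n \near \oo, forall i j,
    (i <= Nseq s n)%N -> (j <= Nseq s n)%N ->
    `|emp_copula n (U w) (V w) (i%:R / (Nseq s n)%:R) (j%:R / (Nseq s n)%:R)
      - copula_cdf mu (i%:R / (Nseq s n)%:R) (j%:R / (Nseq s n)%:R)|
       <= 7 * n%:R `^ (- t).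
Proof.
move=> s0 st t2.
have t02 : 0 < t < 1 / 2 by rewrite (lt_trans s0 st).
pose p n i : R := i%:R / (Nseq s n)%:R.
(* This is the shift 2 e of the sandwich for e = n^-t. It is deterministic, so the six families of
   shifted quadrants and half-planes below are admissible for the concentration bound. *)
pose e n : R := 2 * n%:R `^ (- t).
have near A mA := @freq_count_near R d T P X mu iidX t A t02 mA.
have mI (a : R) : measurable `]-oo, a]%classic by exact: measurable_itv.
have h1 := near (fun n i j => quadrant (p n i + e n) (p n j + e n))
  (fun n i j => measurable_quadrant _ _).
have h2 := near (fun n i j => quadrant (p n i - e n) (p n j - e n))
  (fun n i j => measurable_quadrant _ _).
have h3 := near (fun n i j => `]-oo, p n i + e n]%classic `*` setT)
  (fun n i j => measurableX (mI _) measurableT).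
have h4 := near (fun n i j => `]-oo, p n i - e n]%classic `*` setT)
  (fun n i j => measurableX (mI _) measurableT).
have h5 := near (fun n i j => setT `*` `]-oo, p n i + e n]%classic)
  (fun n i j => measurableX measurableT (mI _)).
have h6 := near (fun n i j => setT `*` `]-oo, p n i - e n]%classic)
  (fun n i j => measurableX measurableT (mI _)).
have F := ae_filter_ringOfSetsType P.
have := @filterI _ _ F _ _ (@filterI _ _ F _ _ h1 h2)
  (@filterI _ _ F _ _ (@filterI _ _ F _ _ h3 h4) (@filterI _ _ F _ _ h5 h6)).
apply: filterS => w.
move=> [[[n1 _ {}h1] [n2 _ {}h2]] [[[n3 _ {}h3] [n4 _ {}h4]] [[n5 _ {}h5] [n6 _ {}h6]]]].
exists (maxn n1 (maxn n2 (maxn n3 (maxn n4 (maxn n5 n6))))).+1 => //.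
move=> [//|m] /= /ltnW; set n := m.+1; rewrite !geq_max.
move=> /and3P[m1 m2 /and4P[m3 m4 m5 m6]] i j iN jN.
have N0 : (0 < Nseq s n)%N by apply: Nseq_gt0; exact: ltW.
have Nn : (Nseq s n <= n)%N by apply: Nseq_le; lra.
have N0' : 0 < (Nseq s n)%:R :> R by rewrite ltr0n.
have p01 k : (k <= Nseq s n)%N -> 0 <= p n k <= 1.
  by move=> kN; rewrite divr_ge0//= ler_pdivrMr// mul1r ler_nat.
have iN' := leq_trans iN Nn; have jN' := leq_trans jN Nn.
have {}h1 := h1 n m1 i j iN' jN'.
have {}h2 := h2 n m2 i j iN' jN'.
have {}h3 := h3 n m3 i j iN' jN'.
have {}h4 := h4 n m4 i j iN' jN'.
(* These sets depend on their first index only, so the second coordinate's index [j] goes there. *)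
have {}h5 := h5 n m5 j j jN' jN'.
have {}h6 := h6 n m6 j j jN' jN'.
rewrite freq_count_quadrant -/(copula_cdf mu _ _) in h1.
rewrite freq_count_quadrant -/(copula_cdf mu _ _) in h2.
rewrite freq_count_fst (copula_fst_marginal hmu) in h3.
rewrite freq_count_fst (copula_fst_marginal hmu) in h4.
rewrite freq_count_snd (copula_snd_marginal hmu) in h5.
rewrite freq_count_snd (copula_snd_marginal hmu) in h6.
apply: (@emp_copula_approx R n (U w) (V w) (copula_cdf mu) (p n i) (p n j)
  (n%:R `^ (- t))) => //.
- exact: p01.
- exact: p01.
- by rewrite -powR_inv1// ler_powR ?ler1n//; lra.
- move=> x y; apply: le_trans (copula_cdf_lip hmu _ _ _) _.
    by rewrite mulr_ge0// powR_ge0.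
  by lra.
- by move=> x y x0 y0; exact: copula_cdf_le.
Qed.

End sample.

(** * Pointwise and L^p convergence of the conditional means *)

Section conclusion.
Context {R : realType}.
Local Notation lambda := (@lebesgue_measure R).

Lemma trunc01_rfun_locally_integrable (k : R.-pker R ~> R) :
  locally_integrable setT (fun x => trunc01 (rfun k x)).
Proof.
split.
- by apply: measurableT_comp; [exact: measurable_trunc01|exact: measurable_rfun].
- exact: openT.
- move=> K _ cK; have mK := compact_measurable cK.
  apply: (@le_lt_trans _ _ (\int[lambda]_(x in K) (cst 1%:E x))%E).
    apply: ge0_le_integral => //.
      apply/measurable_EFinP; apply: measurableT_comp => //; apply: measurable_funTS.
      by apply: measurableT_comp; [exact: measurable_trunc01|exact: measurable_rfun].
    by move=> x _; rewrite lee_fin norm_trunc01.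
  by rewrite integral_cst// mul1e compact_finite_measure.
Qed.

(** A deterministic statement, applied to a single outcome: the functions [E n] only have to be
    close to the copula at the grid points. *)
Lemma rfun_pointwise_cvg (mu : probability (R * R)%type R)
    (E : nat -> R -> R -> R) (kC : R.-pker R ~> R) (K : nat -> R.-pker R ~> R)
    (s t : R) :
  is_copula_measure mu -> 0 < s -> s < t -> markov_kernel_of mu kC ->
  (forall n, (0 < n)%N ->
    markov_kernel_of (checkerboard_measure (E n) (Nseq s n)) (K n)) ->
  (\forall n \near \oo, forall i j, (i <= Nseq s n)%N -> (j <= Nseq s n)%N ->
    `|E n (i%:R / (Nseq s n)%:R) (j%:R / (Nseq s n)%:R)
      - copula_cdf mu (i%:R / (Nseq s n)%:R) (j%:R / (Nseq s n)%:R)|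
       <= 7 * n%:R `^ (- t)) ->
  \forall x \ae lambda, I01 x -> [/\ I01 (rfun kC x),
    forall n, (0 < n)%N -> I01 (rfun (K n) x) &
    (fun n => rfun (K n) x) @ \oo --> rfun kC x].
Proof.
move=> hmu s0 st kmu kK Enear.
have Np n : (0 < Nseq s n.+1)%N by apply: Nseq_gt0; exact: ltW.
have ae1 : \forall x \ae lambda, forall n i, (i < Nseq s n.+1)%N ->
    cellI (Nseq s n.+1) i x -> I01 (rfun (K n.+1) x) /\
    `|rfun (K n.+1) x -
      \sum_(j < Nseq s n.+1) (j%:R + 1 / 2) * cell_mass (E n.+1) (Nseq s n.+1) i j|
      <= (2 * (Nseq s n.+1)%:R)^-1.
  by apply: ae_foralln => n; apply: checkerboard_rfun => //; exact: kK.
(* Grid points lie in no open cell; without these countably many null sets, a point of I has a cell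
   for every n. *)
have ae2 : \forall x \ae lambda, forall n, ~ grid (Nseq s n.+1) x.
  apply: ae_foralln => n; exists (grid (Nseq s n.+1)); split.
  - by apply: countable_measurable => //; exact: card_image_le.
  - exact: grid_null.
  - by move=> x /= /contrapT.
have ae3 := lebesgue_differentiation (trunc01_rfun_locally_integrable kC).
have ae4 := copula_rfun_I01 hmu kmu.
have F := ae_filter_ringOfSetsType lambda.
have := @filterI _ _ F _ _ (@filterI _ _ F _ _ ae1 ae2) (@filterI _ _ F _ _ ae3 ae4).
apply: filterS => x [[{}ae1 {}ae2] [{}ae3 {}ae4]] x01.
have {}ae4 := ae4 x01.
have ex n : exists i, (i < Nseq s n.+1)%N /\ cellI (Nseq s n.+1) i x.
  by have [i iN xi] := exists_cellI (Np n) x01 (ae2 n); exists i.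
have [i iN] := choice ex.
split => //.
  by move=> [//|n] _; have [h1 h2] := iN n; exact: (ae1 n _ h1 h2).1.
rewrite -(cvg_shiftS (fun n => rfun (K n) x)) /=.
pose N n := Nseq s n.+1.
pose A n := (N n)%:R * \int[lambda]_(y in cellJ (N n) (i n)) trunc01 (rfun kC y).
have Acvg : A @ \oo --> rfun kC x.
  (* Differentiation is applied to the truncated function, which agrees with r_C at [x]. *)
  rewrite -(trunc01_id ae4); apply: (lebesgue_diff_cells _ ae3) => //.
  - exact: trunc01_rfun_locally_integrable.
  - by move=> n; apply: cellI_sub_cellJ; exact: (iN n).2.
  - exact: Nseq_inv_cvg0.
(* The two midpoint approximations contribute 1 / (2N) each. The rest is 4 N * 7 n^-t with N <= n^s,
   hence 28 n^(s-t). *)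
pose e n : R := (N n)%:R^-1 + 28 * n.+1%:R `^ (- (t - s)).
have ecvg : e @ \oo --> 0.
  rewrite -[X in _ --> X](addr0 0); apply: cvgD; first exact: Nseq_inv_cvg0.
  rewrite -[X in _ --> X](mulr0 28); apply: cvgMr.
  have := @powR_nat_cvg0 R (t - s); rewrite subr_gt0 => /(_ st).
  by rewrite -cvg_shiftS.
have near_avg : \forall n \near \oo, `|rfun (K n.+1) x - A n| <= e n.
  have [M _ HM] := Enear; exists M => // n /= Mn.
  have [iN1 xi] := iN n; have [_ h1] := ae1 n _ iN1 xi.
  have h2 := copula_rfun_avg iN1 hmu kmu.
  have h3 := cell_mass_sum_close iN1 (HM n.+1 (leqW Mn)).
  rewrite (eq_bigr (fun j : 'I_(Nseq s n.+1) => (j%:R + 1 / 2) *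
    cell_mass (copula_cdf mu) (Nseq s n.+1) (i n) j)) in h2; last first.
    by move=> j _; rewrite copula_cell_mass.
  have h4 : 4 * (Nseq s n.+1)%:R * (7 * n.+1%:R `^ (- t)) <=
      28 * n.+1%:R `^ (- (t - s)).
    have -> : 4 * (Nseq s n.+1)%:R * (7 * n.+1%:R `^ (- t)) =
      28 * ((Nseq s n.+1)%:R * n.+1%:R `^ (- t)) :> R by ring.
    rewrite opprB powRD ?pnatr_eq0 ?implybT// ler_pM2l//.
    by apply: ler_wpM2r; [exact: powR_ge0|exact: Nseq_powR].
  have h5 : (2 * (N n)%:R)^-1 = (N n)%:R^-1 / 2 :> R by rewrite invfM mulrC.
  rewrite -/(N n) h5 in h1 h2; rewrite /e.
  set a := \sum_(j < N n) _ in h1 h3; set b := \sum_(j < N n) _ in h2 h3.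
  have -> : rfun (K n.+1) x - A n = (rfun (K n.+1) x - a) + (a - b) - (A n - b) by ring.
  apply: (le_trans (ler_normB _ _)); apply: (le_trans (lerD (ler_normD _ _) h2)).
  by move: (le_trans h3 h4) h1; lra.
have diff_cvg : (fun n => rfun (K n.+1) x - A n) @ \oo --> 0.
  apply/norm_cvg0P; apply: (@squeeze_cvgr _ _ _ _ (cst 0) e) => //.
    by apply: filterS near_avg => n h; rewrite normr_ge0.
  exact: cvg_cst.
have : (A n + (rfun (K n.+1) x - A n)) @[n --> \oo] --> rfun kC x + 0 by exact: cvgD.
rewrite addr0; apply: cvg_trans.
apply: near_eq_cvg; apply: nearW => n /=.
by rewrite addrCA subrr addr0.
Qed.

(** All values lie in I, so the constant 1 dominates the p-th powers. The outer power 1 / p is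
    applied afterwards, by continuity at 0. *)
Lemma Lpnorm01_cvg0 (p : R) (f : R -> R) (g : nat -> R -> R) : 1 <= p ->
  measurable_fun setT f -> (forall n, measurable_fun setT (g n)) ->
  (\forall x \ae lambda, I01 x -> [/\ I01 (f x), forall n, (0 < n)%N -> I01 (g n x) &
    (fun n => g n x) @ \oo --> f x]) ->
  (fun n => Lpnorm01 p (fun x => g n x - f x)) @ \oo --> 0%E.
Proof.
move=> p1 mf mg fg; have p0 : 0 < p by exact: lt_le_trans p1.
pose h n x := (`|g n.+1 x - f x| `^ p)%:E.
have mh n : measurable_fun (@I01 R) (h n).
  apply/measurable_EFinP; apply: measurable_funTS.
  apply: (measurableT_comp (measurable_powR p)).
  by apply: measurableT_comp => //; exact: measurable_funB.
have [] := @dominated_convergence _ _ R lambda (@I01 R) measurable_I01 h (cst 0%E) (cst 1%E).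
- exact: mh.
- exact: measurable_cst.
- apply: filterS fg => x fg /fg [_ _ gx].
  apply: cvg_EFin; first exact: nearW.
  apply: (powR_seq_cvg0 p0) => //; apply/norm_cvg0P; rewrite /=.
  rewrite -(subrr (f x)); apply: cvgB; last exact: cvg_cst.
  by rewrite (cvg_shiftS (fun n => g n x)).
- apply: (@I01_bound_integrable R _ (cst 1) 1);
    [exact: measurable_I01|by []|exact: measurable_cst|by move=> x; rewrite normr1].
- apply: filterS fg => x fg n /fg [/andP[f0 f1] gI _].
  have /andP[g0 g1] := gI n.+1 isT.
  have h1 : `|g n.+1 x - f x| <= 1 by rewrite ler_norml; apply/andP; split; lra.
  rewrite /h gee0_abs ?lee_fin ?powR_ge0//.
  have : `|g n.+1 x - f x| `^ p <= 1 `^ p.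
    by apply: ge0_ler_powR; rewrite ?nnegrE ?(ltW p0).
  by rewrite powR1.
move=> _ _; rewrite integral0 => hcvg.
rewrite -(cvg_shiftS (fun n => Lpnorm01 p (fun x => g n x - f x))) /=.
pose r n := fine (\int[lambda]_(x in I01) h n x)%E.
move/fine_cvgP: hcvg => [hfin rcvg].
have r0 n : 0 <= r n.
  by apply: fine_ge0; apply: integral_ge0 => x _; rewrite lee_fin powR_ge0.
have : EFin \o (fun n => r n `^ p^-1) @ \oo --> 0%E.
  apply: cvg_EFin; first exact: nearW.
  by apply: powR_seq_cvg0 => //; rewrite invr_gt0.
apply: cvg_trans; apply: near_eq_cvg; apply: filterS hfin => n hn /=.
by rewrite -poweR_EFin fineK.
Qed.

End conclusion.

Theorem theorem23 (R : realType) (d : measure_display) (T : measurableType d)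
  (P : probability T R) (mu : probability (R * R)%type R)
  (X : nat -> T -> (R * R)%type) (s : R)
  (kC : R.-pker R ~> R) (K : T -> nat -> R.-pker R ~> R) :
  is_copula_measure mu ->
  iid_with P X mu ->
  0 < s < 1 / 2 ->
  markov_kernel_of mu kC ->
  (\forall w \ae P, forall n : nat, (0 < n)%N ->
     markov_kernel_of
       (checkerboard_measure
          (emp_copula n (fun i => (X i w).1) (fun i => (X i w).2)) (Nseq s n))
       (K w n)) ->
  \forall w \ae P,
    (\forall x \ae (@lebesgue_measure R), I01 x ->
       (fun n => rfun (K w n) x) @ \oo --> rfun kC x) /\
    (forall p : R, 1 <= p ->
       (fun n => Lpnorm01 p (fun x => rfun (K w n) x - rfun kC x)) @ \oo
         --> 0%E).
Proof.
move=> hmu iidX /andP[s0 s12] kmu hK.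
have [t st t12] : exists2 t : R, s < t & t < 1 / 2.
  by exists ((s + 1 / 2) / 2); lra.
have F := ae_filter_ringOfSetsType P.
(* Both properties have probability one; from here on the outcome [w] is fixed. *)
have := @filterI _ _ F _ _ hK (emp_copula_near iidX hmu s0 st t12).
apply: filterS => w [Kw Ew].
have pointwise := rfun_pointwise_cvg hmu s0 st kmu Kw Ew.
split; first by apply: filterS pointwise => x h /h[].
move=> p p1; apply: Lpnorm01_cvg0 => //; first exact: measurable_rfun.
by move=> n; exact: measurable_rfun.
Qed.
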